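(* Let $(S_{H_n})_{n\in\mathbb N}$ and $(S_{O_n})_{n\in\mathbb N}$ be sequences of measurable spaces. (Direct part.) Suppose that a state $P_{H,O}$ on $\mathcal A_{H,O}=\bigotimes_{n\in\mathbb N}\bigl(L^\infty_{\mathbb C}(S_{H_n})\otimes L^\infty_{\mathbb C}(S_{O_n})\bigr)$ defines a classical hidden process, let $P_H$ be its restriction to $\mathcal A_H$ and let $B_{O,H,n}$, $n\in\mathbb N$, be its emission operators. Then $P_{H,O}$ is uniquely determined by $P_H$, the emission operators $(B_{O,H,n})_{n\in\mathbb N}$ and the conditional independence property, through the identity $$P_{H,O}\Bigl(\prod_{m=0}^n j_{O_m}(f_m)\,j_{H_m}(g_m)\Bigr)=P_H\Bigl(\prod_{m=0}^n j_{H_m}\bigl((B_{O,H,m}f_m)\cdot g_m\bigr)\Bigr)\qquad( * )$$ for all $n\in\mathbb N$, $f_m\in L^\infty_{\mathbb C}(S_{O_m})$ and $g_m\in L^\infty_{\mathbb C}(S_{H_m})$, $m\in\{0,\dots,n\}$. (Converse part.) Conversely, suppose given: (1) a classical stochastic process $H=(H_n)_{n\in\mathbb N}$ with state spaces $S_{H_n}$ and probability distribution $P_H$ (a state on $\mathcal A_H=\bigotimes_{n}L^\infty_{\mathbb C}(S_{H_n})$); (2) for each $n\in\mathbb N$ a measurable space $S_{O_n}$; (3) for each $n\in\mathbb N$ a Markov operator $B_{O,H,n}:L^\infty_{\mathbb C}(S_{O_n})\to L^\infty_{\mathbb C}(S_{H_n})$. Then the right-hand side of $( * )$ defines a unique state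 $P_{H,O}$ on $\mathcal A_{H,O}$ and a unique classical process $(O_n)$ such that: (i) the processes $(H_n)$ and $(O_n)$ form a classical hidden process; (ii) the joint expectations of the $(H,O)$-process are given by $( * )$. In particular the restriction of $P_{H,O}$ to the $*$-subalgebra $\mathcal A_H\equiv\bigotimes_{n\in\mathbb N}\bigl(L^\infty_{\mathbb C}(S_{H_n})\otimes 1\bigr)$ coincides with $P_H$.
   Context: For a measurable space $S$, $L^\infty_{\mathbb C}(S)$ is the $*$-algebra of bounded complex measurable functions on $S$. All tensor products are algebraic; an infinite tensor product of unital algebras is the union of the finite ones (completed by units in the remaining factors). A state is a positive normalized linear functional. A Markov operator is a completely positive identity preserving linear map. $j_{H_n}$ and $j_{O_n}$ are the natural embeddings of $L^\infty_{\mathbb C}(S_{H_n})$ and $L^\infty_{\mathbb C}(S_{O_n})$ into the corresponding factor of $\mathcal A_{H,O}$ (units elsewhere); one also writes $g(H_n)=j_{H_n}(g)$, $f(O_n)=j_{O_n}(f)$. Put $\mathcal A_{H_n}=j_{H_n}(L^\infty_{\mathbb C}(S_{H_n}))$, $\mathcal A_{O_n}=j_{O_n}(L^\infty_{\mathbb C}(S_{O_n}))$, and let $\mathcal A_{H_0,\dots,H_n}$ be the algebra generated by $\mathcal A_{H_0},\dots,\mathcal A_{H_n}$. $\mathcal A_H$ is the algebra generated by all $\mathcal A_{H_n}$. Given a state $P$ on $\mathcal A_{H,O}$ and a $*$-subalgebra $\mathcal C$, the $P$-conditional expectation of $a$ onto $\mathcal C$ is an element $E(a)\in\mathcal C$ with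 $P(ac)=P(E(a)c)$ for all $c\in\mathcal C$; equalities between conditional expectations are understood modulo elements $c$ with $P(c^*c)=0$. Write $E_{H_0,\dots,H_n}$ and $E_{H_m}$ for the $P_{H,O}$-conditional expectations onto $\mathcal A_{H_0,\dots,H_n}$ and $\mathcal A_{H_m}$. A state $P_{H,O}$ on $\mathcal A_{H,O}$ (with the embeddings $j_{H_n}\otimes j_{O_n}$) is a classical hidden process if the conditional expectations below exist, each $E_{H_m}$ restricted to $\mathcal A_{O_m}$ is given by a Markov operator $\mathcal A_{O_m}\to\mathcal A_{H_m}$, and the $O$-process is conditionally independent of the $H$-process in the sense that, for all $n\in\mathbb N$ and $f_m\in L^\infty_{\mathbb C}(S_{O_m})$, $$E_{H_0,\dots,H_n}\Bigl(\prod_{m=0}^n j_{O_m}(f_m)\Bigr)=\prod_{m=0}^nE_{H_m}(j_{O_m}(f_m)).$$ The $n$-th emission operator is the Markov operator $B_{O,H,n}=j_{H_n}^{-1}\circ E_{H_n}\circ j_{O_n}:L^\infty_{\mathbb C}(S_{O_n})\to L^\infty_{\mathbb C}(S_{H_n})$. Uniqueness of processes is up to equality of joint expectations. *)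

(* Defs.v *)
From HB Require Import structures.
From mathcomp Require Import all_boot all_order all_algebra.
From mathcomp Require Import generic_quotient.
From mathcomp Require Import all_classical all_reals all_analysis.
From mathcomp Require Import measurable_realfun complex.

Set Implicit Arguments.
Unset Strict Implicit.
Unset Printing Implicit Defensive.

Import Order.TTheory GRing.Theory Num.Theory.
Import numFieldNormedType.Exports.

Local Open Scope classical_set_scope.
Local Open Scope ring_scope.

HB.mixin Record isStarAlg (K : numClosedFieldType) A
    of GRing.ComAlgebra K A := {
  star : A -> A;
  starK : involutive star;
  starD : {morph star : x y / x + y};
  starM : forall x y : A, star (x * y) = star y * star x;
  starZ : forall (k : K) (x : A), star (k *: x) = k^* *: star x
}.

#[short(type="comStarAlgType")]
HB.structure Definition ComStarAlg (K : numClosedFieldType) :=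
  {A of GRing.ComAlgebra K A & isStarAlg K A}.

Lemma star1 (K : numClosedFieldType) (A : comStarAlgType K) :
  star (1 : A) = 1.
Proof. by rewrite -[LHS]mulr1 -{2}(starK 1) -starM mulr1 starK. Qed.

(* Needed only to see that a tensor product of non-zero algebras is non-zero. *)
Lemma unital_functional (K : fieldType) (A : comAlgType K) :
  exists phi : A -> K, [/\ forall x y, phi (x + y) = phi x + phi y,
    forall k x, phi (k *: x) = k * phi x & phi 1 = 1].
Proof.
pose P (H : set A) := (forall k x y, H x -> H y -> H (k *: x + y)) /\ ~ H 1.
have [F FP Ftot|H [[HL H1] Hmax]] := @Zorn_bigcup A P.
  split=> [k x y [X FX Xx] [Y FY Yy]|[X FX]]; last exact: (FP _ FX).2.
  have [XY|YX] := Ftot _ _ FX FY.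
  - by exists Y => //; apply: (FP _ FY).1 => //; exact: XY.
  - by exists X => //; apply: (FP _ FX).1 => //; exact: YX.
have H0 : H 0.
  apply: contrapT => nH0; apply: (Hmax (H `|` [set 0])).
    split; first by move=> x; left.
    by move=> E; apply: nH0; apply: E; right.
  split=> [k x y [Hx|->] [Hy|->]|[//|/eqP]]; last by rewrite oner_eq0.
  - by left; exact: HL.
  - left; have Hxx : H (- 1 *: x + x) by exact: HL.
    by case: nH0; rewrite scaleN1r addNr in Hxx.
  - by left; rewrite scaler0 add0r.
  - by right; rewrite scaler0 addr0.
have HZ k x : H x -> H (k *: x) by move=> Hx; rewrite -[_ *: _]addr0; exact: HL.
have HD x y : H x -> H y -> H (x + y).
  by move=> Hx Hy; rewrite -[x]scale1r; exact: HL.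
have ex x : exists c, H (x - c%:A).
  apply: contrapT => nex; pose G := [set y | exists k, H (y - k *: x)].
  have HG : H `<=` G by move=> y Hy; exists 0; rewrite scale0r subr0.
  have Gx : G x by exists 1; rewrite scale1r subrr.
  apply: (Hmax G).
    split=> // GH; apply: nex; exists 0; rewrite scale0r subr0.
    exact: GH.
  split=> [k y z [l Hy] [m Hz]|[k Hk]].
    exists (k * l + m); rewrite scalerDl opprD addrACA -scalerA -scalerBr.
    exact: HL.
  have [k0|k0] := eqVneq k 0; first by move: Hk; rewrite k0 scale0r subr0.
  apply: nex; exists k^-1.
  have /(HZ (- k^-1)) := Hk.
  by rewrite scalerBr scalerA mulNr mulVf// scaleN1r opprK scaleNr addrC.
have uniq c : H (c%:A) -> c = 0.
  move=> Hc; apply: contrapT => /eqP c0; apply: H1.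
  by have := HZ c^-1 _ Hc; rewrite scalerA mulVf// scale1r.
pose phi x := sval (cid (ex x)).
have phiP x : H (x - (phi x)%:A) by rewrite /phi; case: cid.
have phiE x c : H (x - c%:A) -> phi x = c.
  move=> Hc; apply/eqP; rewrite -subr_eq0; apply/eqP/uniq.
  have := HD _ _ Hc (HZ (-1) _ (phiP x)).
  by rewrite scaleN1r opprB addrC addrA subrK -scalerBl.
exists phi; split=> [x y|k x|].
- by apply: phiE; rewrite scalerDl opprD addrACA; exact: HD.
- by apply: phiE; rewrite -scalerA -scalerBr; exact: HZ.
- by apply: phiE; rewrite scale1r subrr.
Qed.

(* The algebraic tensor product of a family of unital algebras: the free vector
   space on the families (a_i) with a_i = 1 for all but finitely many i, modulo
   multilinearity. This is the union of the finite tensor products, completed by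
   units in the remaining factors. *)
Section Tensor.
Variables (K : numClosedFieldType) (I : choiceType) (A : I -> comStarAlgType K).

Record fam := Fam {
  fam_val :> forall i, A i;
  fam_fin : finite_set [set i | fam_val i <> 1]
}.

HB.instance Definition _ := gen_eqMixin fam.
HB.instance Definition _ := gen_choiceMixin fam.

Lemma fam_ext (a b : fam) : (forall i, a i = b i) -> a = b.
Proof.
case: a b => [a ha] [b hb] /= ab.
have {ab} ab : a = b by exact: functional_extensionality_dep.
by case: b / ab hb => hb; congr Fam; exact: Prop_irrelevance.
Qed.

Program Definition fam1 : fam := @Fam (fun=> 1) _.
Next Obligation.
apply: sub_finite_set (finite_set0 _) => i /=; exact.
Qed.

Program Definition famM (a b : fam) : fam := @Fam (fun i => a i * b i) _.
Next Obligation.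
move=> a b; have abfin : finite_set ([set i | a i <> 1] `|` [set i | b i <> 1]).
  by rewrite finite_setU; split; exact: fam_fin.
apply: sub_finite_set abfin => i /= ab1; apply: contrapT => /not_orP[/contrapT a1 /contrapT b1].
by apply: ab1; rewrite a1 b1 mulr1.
Qed.

Program Definition fam_star (a : fam) : fam := @Fam (fun i => star (a i)) _.
Next Obligation.
move=> a; apply: sub_finite_set (fam_fin a) => i /= sa1 a1.
by apply: sa1; rewrite a1 star1.
Qed.

Program Definition fam_at (i : I) (x : A i) : fam :=
  @Fam (eqtype.dfwith (fun j => 1 : A j) x) _.
Next Obligation.
move=> i x; apply: sub_finite_set (finite_set1 i) => j /= ji1.
apply: contrapT => /eqP ji; apply: ji1.
by rewrite dfwith_out // eq_sym.
Qed.

(* [tsum] are the formal sums of terms k (a_i)_i. The first seven constructors of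
   [teq] present the free vector space on [fam], the last two add linearity in
   each slot. *)
Definition tsum := seq (K * fam).

Inductive teq : tsum -> tsum -> Prop :=
| teq_refl s : teq s s
| teq_sym s t : teq s t -> teq t s
| teq_trans s t u : teq s t -> teq t u -> teq s u
| teq_cat s s' t t' : teq s s' -> teq t t' -> teq (s ++ t) (s' ++ t')
| teq_catC s t : teq (s ++ t) (t ++ s)
| teq_coef0 a : teq [:: (0, a)] [::]
| teq_coefD k l a : teq [:: (k + l, a)] [:: (k, a); (l, a)]
| teq_slotZ i k l (a b : fam) :
    (forall j, j != i -> a j = b j) -> a i = l *: b i ->
    teq [:: (k, a)] [:: (k * l, b)]
| teq_slotD i k (a b c : fam) :
    (forall j, j != i -> a j = b j /\ a j = c j) -> a i = b i + c i ->
    teq [:: (k, a)] [:: (k, b); (k, c)].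

Definition teqb : rel tsum := fun s t => `[< teq s t >].

Lemma teqb_refl : reflexive teqb.
Proof. by move=> s; apply/asboolP; exact: teq_refl. Qed.
Lemma teqb_sym : symmetric teqb.
Proof. by move=> s t; apply/asboolP/asboolP; exact: teq_sym. Qed.
Lemma teqb_trans : transitive teqb.
Proof.
by move=> t s u /asboolP st /asboolP tu; apply/asboolP; exact: teq_trans tu.
Qed.

Canonical teq_equiv := EquivRel teqb teqb_refl teqb_sym teqb_trans.

Definition tensor := {eq_quot teq_equiv}%qT.
HB.instance Definition _ := Choice.on tensor.

Definition tcl (s : tsum) : tensor := \pi_({eq_quot teq_equiv})%qT s.
Definition trepr (x : tensor) : tsum := (repr (x : {eq_quot teq_equiv}))%qT.

Lemma treprK : cancel trepr tcl.
Proof. by move=> x; exact: reprK. Qed.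

Lemma tclP s t : tcl s = tcl t <-> teq s t.
Proof. by split=> [/eqmodP/asboolP|st]//; apply/eqmodP/asboolP. Qed.

Lemma trepr_tcl s : teq (trepr (tcl s)) s.
Proof. by apply/tclP; rewrite treprK. Qed.

Definition tadd (x y : tensor) : tensor := tcl (trepr x ++ trepr y).
Definition tscale (k : K) (x : tensor) : tensor :=
  tcl [seq (k * p.1, p.2) | p <- trepr x].

Lemma tadd_tcl s t : tadd (tcl s) (tcl t) = tcl (s ++ t).
Proof. by apply/tclP/teq_cat; exact: trepr_tcl. Qed.

Lemma teq_scale k s t : teq s t ->
  teq [seq (k * p.1, p.2) | p <- s] [seq (k * p.1, p.2) | p <- t].
Proof.
elim=> {s t}.
- by move=> s; exact: teq_refl.
- by move=> s t _; exact: teq_sym.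
- by move=> s t u _ + _; exact: teq_trans.
- by move=> s s' t t' _ ss _ tt; rewrite !map_cat; exact: teq_cat.
- by move=> s t; rewrite !map_cat; exact: teq_catC.
- by move=> a /=; rewrite mulr0; exact: teq_coef0.
- by move=> l m a /=; rewrite mulrDr; exact: teq_coefD.
- by move=> i l m a b ab abi /=; rewrite mulrA; apply: teq_slotZ abi.
- by move=> i l a b c abc abci /=; apply: teq_slotD abci.
Qed.

Lemma tscale_tcl k s : tscale k (tcl s) = tcl [seq (k * p.1, p.2) | p <- s].
Proof. by apply/tclP/teq_scale; exact: trepr_tcl. Qed.

Fact taddA : associative tadd.
Proof.
move=> x y z; rewrite -[x]treprK -[y]treprK -[z]treprK.
by rewrite !tadd_tcl catA.
Qed.
Fact taddC : commutative tadd.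
Proof.
move=> x y; rewrite -[x]treprK -[y]treprK !tadd_tcl.
by apply/tclP; exact: teq_catC.
Qed.
Fact tadd0 : left_id (tcl [::]) tadd.
Proof. by move=> x; rewrite -[x]treprK tadd_tcl. Qed.

HB.instance Definition _ := GRing.isNmodule.Build tensor taddA taddC tadd0.

Lemma tclD s t : tcl (s ++ t) = tcl s + tcl t.
Proof. by rewrite -tadd_tcl. Qed.

Lemma tcl_cons p s : tcl (p :: s) = tcl [:: p] + tcl s.
Proof. exact: (tclD [:: p] s). Qed.

Fact taddN : left_inverse (0 : tensor) (tscale (-1)) +%R.
Proof.
move=> x; rewrite -[x]treprK tscale_tcl; elim: (trepr x) => [|[k a] s ih].
  exact: (tadd0 (tcl [::])).
rewrite map_cons [X in X + _ = _]tcl_cons [X in _ + X = _]tcl_cons addrACA ih addr0.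
rewrite -tclD mulN1r; apply/tclP/teq_trans/teq_coef0.
by rewrite -(addNr k); apply/teq_sym/teq_coefD.
Qed.

HB.instance Definition _ := GRing.Nmodule_isZmodule.Build tensor taddN.

Fact tscaleA k l x : tscale k (tscale l x) = tscale (k * l) x.
Proof.
rewrite -[x]treprK !tscale_tcl -map_comp; congr tcl.
by apply: eq_map => p /=; rewrite mulrA.
Qed.
Fact tscale1 : left_id 1 tscale.
Proof.
move=> x; rewrite -[x]treprK tscale_tcl; congr tcl.
by rewrite -[RHS]map_id; apply: eq_map => -[k a] /=; rewrite mul1r.
Qed.
Fact tscaleDr : right_distributive tscale +%R.
Proof.
move=> k x y; rewrite -[x]treprK -[y]treprK -tclD !tscale_tcl.
by rewrite map_cat tclD.
Qed.
Fact tscaleDl x : {morph tscale^~ x : k l / k + l}.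
Proof.
move=> k l; rewrite -[x]treprK !tscale_tcl; elim: (trepr x) => [|[m a] s ih] /=.
  by rewrite [RHS](tadd0 (tcl [::])).
rewrite tcl_cons ih [X in _ = X + _]tcl_cons [X in _ = _ + X]tcl_cons.
rewrite addrACA; congr (_ + _).
by rewrite -tclD; apply/tclP; rewrite mulrDl; exact: teq_coefD.
Qed.

HB.instance Definition _ :=
  GRing.Zmodule_isLmodule.Build K tensor tscaleA tscale1 tscaleDr tscaleDl.

Lemma scale_tcl1 (k l : K) (a : fam) :
  k *: tcl [:: (l, a)] = tcl [:: (k * l, a)].
Proof. exact: (tscale_tcl k [:: (l, a)]). Qed.

(* The additive extension to [tensor] of a map F on terms k (a_i)_i, meaningful
   when F satisfies [tcompat]. *)
Definition tfold (V : nmodType) (F : K -> fam -> V) (x : tensor) : V :=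
  \sum_(p <- trepr x) F p.1 p.2.

Definition tcompat (V : nmodType) (F : K -> fam -> V) :=
  [/\ forall a, F 0 a = 0,
      forall k l a, F (k + l) a = F k a + F l a,
      forall i k l (a b : fam), (forall j, j != i -> a j = b j) ->
        a i = l *: b i -> F k a = F (k * l) b &
      forall i k (a b c : fam), (forall j, j != i -> a j = b j /\ a j = c j) ->
        a i = b i + c i -> F k a = F k b + F k c].

Lemma tfold_tcl (V : nmodType) (F : K -> fam -> V) s : tcompat F ->
  tfold F (tcl s) = \sum_(p <- s) F p.1 p.2.
Proof.
move=> [F0 FD FsZ FsD]; rewrite /tfold.
have := trepr_tcl s; move: (trepr _) => r; elim=> {r s} //.
- by move=> s t u _ -> _ ->.
- by move=> s s' t t' _ ss _ tt; rewrite !big_cat /= ss tt.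
- by move=> s t; rewrite !big_cat /= addrC.
- by move=> a; rewrite big_seq1 big_nil /= F0.
- by move=> k l a; rewrite big_seq1 big_cons big_seq1 /= FD.
- by move=> i k l a b ab abi; rewrite !big_seq1; exact: FsZ abi.
- by move=> i k a b c ab abi; rewrite big_seq1 big_cons big_seq1; exact: FsD abi.
Qed.

Lemma tfoldD (V : nmodType) (F : K -> fam -> V) : tcompat F ->
  {morph tfold F : x y / x + y}.
Proof.
move=> cF x y; rewrite -[x]treprK -[y]treprK -tclD !tfold_tcl//.
by rewrite big_cat.
Qed.

Lemma tfold1 (V : nmodType) (F : K -> fam -> V) k a : tcompat F ->
  tfold F (tcl [:: (k, a)]) = F k a.
Proof. by move=> cF; rewrite tfold_tcl// big_seq1. Qed.

Lemma tensor_ind (P : tensor -> Prop) : P 0 ->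
  (forall k a x, P x -> P (tcl [:: (k, a)] + x)) -> forall x, P x.
Proof.
move=> P0 PD x; rewrite -[x]treprK; elim: (trepr x) => [|[k a] s ih]//.
by rewrite tcl_cons; exact: PD.
Qed.

Lemma tcompat_tcl (c d : K -> K) (h : fam -> fam) :
  c 0 = 0 -> {morph c : k l / k + l} -> (forall k l, c (k * l) = c k * d l) ->
  (forall (a b : fam) i, a i = b i -> h a i = h b i) ->
  (forall (a b : fam) i l, a i = l *: b i -> h a i = d l *: h b i) ->
  (forall (a b e : fam) i, a i = b i + e i -> h a i = h b i + h e i) ->
  tcompat (fun k a => tcl [:: (c k, h a)]).
Proof.
move=> c0 cD cM hE hZ hD; split.
- by move=> a; rewrite c0; apply/tclP/teq_coef0.
- by move=> k l a; rewrite cD -tclD; apply/tclP/teq_coefD.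
- move=> i k l a b ab abi; rewrite cM; apply/tclP.
  by apply: (@teq_slotZ i) => [j /ab/hE|]//; exact: hZ.
- move=> i k a b e ab abi; rewrite -tclD; apply/tclP.
  by apply: (@teq_slotD i) => [j /ab[/hE ? /hE ?]|]//; exact: hD.
Qed.

Definition tmul (x y : tensor) : tensor :=
  tfold (fun k a => tfold (fun l b => tcl [:: (k * l, famM a b)]) y) x.

Lemma tmul_compatr k a : tcompat (fun l b => tcl [:: (k * l, famM a b)]).
Proof.
apply: (@tcompat_tcl _ id).
- by rewrite mulr0.
- by move=> l m; rewrite mulrDr.
- by move=> l m; rewrite mulrA.
- by move=> b b' i /= ->.
- by move=> b b' i l /= ->; rewrite -scalerAr.
- by move=> b b' e i /= ->; rewrite mulrDr.
Qed.

Lemma tmul_compatl1 l b : tcompat (fun k a => tcl [:: (k * l, famM a b)]).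
Proof.
apply: (@tcompat_tcl _ id).
- by rewrite mul0r.
- by move=> k m; rewrite mulrDl.
- by move=> k m; rewrite mulrAC.
- by move=> a a' i /= ->.
- by move=> a a' i k /= ->; rewrite scalerAl.
- by move=> a a' e i /= ->; rewrite mulrDl.
Qed.

Lemma tmul_compatl y :
  tcompat (fun k a => tfold (fun l b => tcl [:: (k * l, famM a b)]) y).
Proof.
elim/tensor_ind: y => [|l b y [c0 cD cZ cS]].
  have t0 k a : tfold (fun l b => tcl [:: (k * l, famM a b)]) 0 = 0.
    by rewrite (tfold_tcl [::] (tmul_compatr k a)) big_nil.
  by split=> *; rewrite !t0 ?addr0.
have [d0 dD dZ dS] := tmul_compatl1 l b.
split.
- by move=> a; rewrite tfoldD ?tfold1 ?c0 ?d0 ?addr0//; exact: tmul_compatr.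
- move=> k m a.
  rewrite !tfoldD ?tfold1; do ?exact: tmul_compatr.
  by rewrite cD dD addrACA.
- move=> i k m a a' aa aai.
  rewrite !tfoldD ?tfold1; do ?exact: tmul_compatr.
  by rewrite (cZ i k m a a')// (dZ i k m a a').
- move=> i k a a' e aa aai.
  rewrite !tfoldD ?tfold1; do ?exact: tmul_compatr.
  by rewrite (cS i k a a' e)// (dS i k a a' e)// addrACA.
Qed.

Lemma tmul1 k a l b :
  tmul (tcl [:: (k, a)]) (tcl [:: (l, b)]) = tcl [:: (k * l, famM a b)].
Proof.
by rewrite /tmul tfold1 ?tfold1//; [exact: tmul_compatr|exact: tmul_compatl].
Qed.

Fact tmulDl : left_distributive tmul +%R.
Proof. by move=> x y z; rewrite /tmul tfoldD//; exact: tmul_compatl. Qed.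

Fact tmulC : commutative tmul.
Proof.
have t0 (x : tensor) : tmul 0 x = 0.
  by rewrite /tmul (tfold_tcl [::] (tmul_compatl x)) big_nil.
have t0r (x : tensor) : tmul x 0 = 0.
  elim/tensor_ind: x => [|k a x ih]; first exact: t0.
  rewrite tmulDl ih addr0 /tmul tfold1; last exact: tmul_compatl.
  by rewrite (tfold_tcl [::] (tmul_compatr k a)) big_nil.
have tDr (x y z : tensor) : tmul x (y + z) = tmul x y + tmul x z.
  elim/tensor_ind: x => [|k a x ih]; first by rewrite !t0 addr0.
  rewrite !tmulDl ih addrACA; congr (_ + _).
  rewrite /tmul !tfold1; do ?exact: tmul_compatl.
  by rewrite tfoldD//; exact: tmul_compatr.
move=> x y; elim/tensor_ind: x => [|k a x ih]; first by rewrite t0 t0r.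
rewrite tmulDl tDr ih; congr (_ + _).
elim/tensor_ind: y {ih} => [|l b y ih]; first by rewrite t0 t0r.
rewrite tmulDl tDr ih !tmul1 mulrC; congr (tcl [:: (_, _)] + _).
by apply: fam_ext => i /=; rewrite mulrC.
Qed.

Fact tmulDr : right_distributive tmul +%R.
Proof. by move=> x y z; rewrite tmulC tmulDl ![tmul _ x]tmulC. Qed.

Fact tmul0x (x : tensor) : tmul 0 x = 0.
Proof. by rewrite /tmul (tfold_tcl [::] (tmul_compatl x)) big_nil. Qed.

Fact tmulA : associative tmul.
Proof.
move=> x y z; elim/tensor_ind: x => [|k a x ih]; first by rewrite !tmul0x.
rewrite !tmulDl ih; congr (_ + _).
elim/tensor_ind: y {ih} => [|l b y ih].
  by rewrite tmul0x ![tmul _ 0]tmulC !tmul0x.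
rewrite tmulDl !tmulDr tmulDl ih; congr (_ + _).
elim/tensor_ind: z {ih} => [|m c z ih].
  by rewrite ![tmul _ 0]tmulC !tmul0x tmulC tmul0x.
rewrite !tmulDr ih !tmul1 mulrA; congr (tcl [:: (_, _)] + _).
by apply: fam_ext => i /=; rewrite mulrA.
Qed.

Fact tmul1x : left_id (tcl [:: (1, fam1)]) tmul.
Proof.
move=> x; elim/tensor_ind: x => [|k a x ih].
  by rewrite tmulC tmul0x.
rewrite tmulDr ih tmul1 mul1r; congr (tcl [:: (_, _)] + _).
by apply: fam_ext => i /=; rewrite mul1r.
Qed.

Lemma tensor_neq0 : tcl [:: (1, fam1)] != 0 :> tensor.
Proof.
pose phi i := sval (cid (unital_functional (A i))).
have phiP i : [/\ forall x y, phi i (x + y) = phi i x + phi i y,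
    forall k x, phi i (k *: x) = k * phi i x & phi i 1 = 1].
  exact: (svalP (cid (unital_functional (A i)))).
pose supp (a : fam) := [set i | a i <> 1].
pose ev k (a : fam) := k * \big[*%R/1]_(i \in [set: I]) phi i (a i).
have evE i k (a : fam) (D : set I) : finite_set D -> supp a `<=` D ->
    ev k a = k * (phi i (a i) * \big[*%R/1]_(j \in (D `|` [set i]) `\ i)
      phi j (a j)).
  move=> Dfin aD; rewrite /ev.
  rewrite -(fsbigD1 i (D `|` [set i]) (fun j => phi j (a j))); last 2 first.
  - by rewrite finite_setU; split => //; exact: finite_set1.
  - by right.
  rewrite (fsbig_widen (D `|` [set i]) setT)// => j [_ nDj] /=.
  have [_ _ phi1] := phiP j; rewrite -phi1; congr (phi j _).
  by apply: contrapT => aj; apply: nDj; left; exact: aD.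
have restE i (a b : fam) (D : set I) : (forall j, j != i -> a j = b j) ->
    \big[*%R/1]_(j \in (D `|` [set i]) `\ i) phi j (a j) =
    \big[*%R/1]_(j \in (D `|` [set i]) `\ i) phi j (b j).
  move=> ab; apply: eq_fsbigr => j; rewrite inE => -[_ /= /eqP ji].
  by rewrite ab.
have Dfin (a b c : fam) : finite_set (supp a `|` supp b `|` supp c).
  by rewrite !finite_setU; do !split; exact: fam_fin.
have aD (a b c : fam) : supp a `<=` supp a `|` supp b `|` supp c.
  by move=> i; left; left.
have bD (a b c : fam) : supp b `<=` supp a `|` supp b `|` supp c.
  by move=> i; left; right.
have cD (a b c : fam) : supp c `<=` supp a `|` supp b `|` supp c.
  by move=> i; right.
have evC : tcompat ev.
  split.
  - by move=> a; rewrite /ev mul0r.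
  - by move=> k l a; rewrite /ev mulrDl.
  - move=> i k l a b ab abi; have [_ phiZ _] := phiP i.
    rewrite (evE i k a _ (Dfin a b b))// (evE i _ b _ (Dfin a b b))//.
    by rewrite abi phiZ (restE _ _ _ _ ab) !mulrA.
  - move=> i k a b c ab abi; have [phiD _ _] := phiP i.
    rewrite (evE i k a _ (Dfin a b c))// (evE i _ b _ (Dfin a b c))//.
    rewrite (evE i _ c _ (Dfin a b c))// abi phiD.
    rewrite -(@restE i a b)//; last by move=> j /ab[].
    rewrite -(@restE i a c)//; last by move=> j /ab[].
    by rewrite mulrDl mulrDr.
apply/eqP => /(congr1 (tfold ev)).
rewrite tfold1// (tfold_tcl [::] evC) big_nil /ev mul1r fsbig1.
  by move/eqP; rewrite oner_eq0.
by move=> i _; have [_ _] := phiP i.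
Qed.

HB.instance Definition _ := GRing.Zmodule_isComNzRing.Build tensor
  tmulA tmulC tmul1x tmulDl tensor_neq0.

Fact tscaleAl k (x y : tensor) : k *: (x * y) = (k *: x) * y.
Proof.
elim/tensor_ind: x => [|l a x ih]; first by rewrite mul0r !scaler0 mul0r.
rewrite mulrDl !scalerDr ih mulrDl; congr (_ + _).
elim/tensor_ind: y {ih} => [|m b y ih]; first by rewrite !mulr0 scaler0.
rewrite !mulrDr scalerDr ih; congr (_ + _).
rewrite scale_tcl1 [X in _ *: X]tmul1 scale_tcl1 [RHS]tmul1.
by rewrite mulrA.
Qed.

HB.instance Definition _ := GRing.Lmodule_isLalgebra.Build K tensor tscaleAl.
HB.instance Definition _ := GRing.Lalgebra_isComAlgebra.Build K tensor.

Definition tstar (x : tensor) : tensor :=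
  tfold (fun k a => tcl [:: (k^*, fam_star a)]) x.

Lemma tstar_compat : tcompat (fun k a => tcl [:: (k^*, fam_star a)]).
Proof.
apply: (@tcompat_tcl _ (fun l => l^*)).
- exact: conjC0.
- exact: rmorphD.
- exact: rmorphM.
- by move=> a b i /= ->.
- by move=> a b i l /= ->; rewrite starZ.
- by move=> a b e i /= ->; rewrite starD.
Qed.

Lemma tstar1 k a : tstar (tcl [:: (k, a)]) = tcl [:: (k^*, fam_star a)].
Proof. by rewrite /tstar tfold1//; exact: tstar_compat. Qed.

Fact tstar0 : tstar 0 = 0.
Proof. by rewrite /tstar (tfold_tcl [::] tstar_compat) big_nil. Qed.

Fact tstarD : {morph tstar : x y / x + y}.
Proof. exact: (tfoldD tstar_compat). Qed.

Fact tstarK : involutive tstar.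
Proof.
elim/tensor_ind => [|k a x ih]; first by rewrite !tstar0.
rewrite !tstarD ih !tstar1 conjCK; congr (tcl [:: (_, _)] + _).
by apply: fam_ext => i /=; rewrite starK.
Qed.

Fact tstarM (x y : tensor) : tstar (x * y) = tstar y * tstar x.
Proof.
elim/tensor_ind: x => [|k a x ih]; first by rewrite mul0r tstar0 mulr0.
rewrite mulrDl !tstarD ih mulrDr; congr (_ + _).
elim/tensor_ind: y {ih} => [|l b y ih]; first by rewrite mulr0 tstar0 mul0r.
rewrite mulrDr !tstarD ih mulrDl; congr (_ + _).
rewrite [_ * _]tmul1 !tstar1 [RHS]tmul1 rmorphM mulrC; congr (tcl [:: (_, _)]).
by apply: fam_ext => i /=; rewrite starM.
Qed.

Fact tstarZ k (x : tensor) : tstar (k *: x) = k^* *: tstar x.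
Proof.
elim/tensor_ind: x => [|l a x ih]; first by rewrite scaler0 tstar0 scaler0.
rewrite scalerDr !tstarD ih scalerDr; congr (_ + _).
by rewrite scale_tcl1 !tstar1 scale_tcl1 rmorphM.
Qed.

HB.instance Definition _ :=
  isStarAlg.Build K tensor tstarK tstarD tstarM tstarZ.

Definition tpure (a : fam) : tensor := tcl [:: (1, a)].

Definition tin (i : I) (x : A i) : tensor := tpure (fam_at x).

Lemma tin1 i : tin (1 : A i) = 1.
Proof.
congr (tcl [:: (_, _)]); apply: fam_ext => j /=.
by case: eqtype.dfwithP.
Qed.

End Tensor.

Arguments tensor {K I} A.
Arguments tin {K I A} i x.

(* The tensor product of the linear unital maps h_i : A_i -> B_i. *)
Section TensorMap.
Variables (K : numClosedFieldType) (I : choiceType) (A B : I -> comStarAlgType K).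
Variables (h : forall i, A i -> B i) (h1 : forall i, h (1 : A i) = 1).

Program Definition fam_map (a : fam A) : fam B :=
  @Fam K I B (fun i => h (a i)) _.
Next Obligation.
move=> a; apply: sub_finite_set (fam_fin a) => i /= ha1 a1.
by apply: ha1; rewrite a1 h1.
Qed.

Definition tmap (x : tensor A) : tensor B :=
  tfold (fun k a => k *: tpure (fam_map a)) x.

Lemma tmap_pure (a : fam A) : (forall i, linear (@h i)) ->
  tmap (tpure a) = tpure (fam_map a).
Proof.
move=> hl.
have hZ i k x : h (k *: x) = k *: h (x : A i).
  have := hl i k x 0; rewrite !addr0 => ->.
  have /eqP := hl i 1 0 0.
  by rewrite !scale1r addr0 -subr_eq subrr eq_sym => /eqP ->; rewrite addr0.
have hD i (x y : A i) : h (x + y) = h x + h y.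
  by rewrite -[x in LHS]scale1r hl scale1r.
rewrite /tmap tfold1 ?scale1r//; split.
- by move=> b; rewrite scale0r.
- by move=> k l b; rewrite scalerDl.
- move=> i k l b c bc bci; rewrite !scale_tcl1 !mulr1; apply/tclP.
  apply: (@teq_slotZ _ _ _ i) => [j /bc /= ->//|/=].
  by rewrite bci hZ.
- move=> i k b c e bc bci; rewrite !scale_tcl1 !mulr1 -tclD; apply/tclP.
  apply: (@teq_slotD _ _ _ i) => [j /bc /= [ab ac]|/=].
    by rewrite -ab -ac.
  by rewrite bci hD.
Qed.

End TensorMap.

(* Bounded measurable functions S -> C, not identified almost everywhere. *)
Section Linf.
Variables (R : realType) (d : measure_display) (S : measurableType d).

Definition bounded_measurable (f : S -> R[i]) : Prop :=
  [/\ measurable_fun [set: S] (fun s => complex.Re (f s)),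
      measurable_fun [set: S] (fun s => complex.Im (f s)) &
      exists M : R[i], forall s, `|f s| <= M].

Definition Linf_pred : {pred S -> R[i]} := fun f => `[< bounded_measurable f >].

Record Linf := MkLinf { Linf_fun :> S -> R[i]; _ : Linf_pred Linf_fun }.

HB.instance Definition _ := [isSub for Linf_fun].
HB.instance Definition _ := [Choice of Linf by <:].

Lemma LinfP (f : Linf) : bounded_measurable f.
Proof. by apply/asboolP; exact: (valP f). Qed.

Lemma bounded_measurableD (f g : S -> R[i]) :
  bounded_measurable f -> bounded_measurable g -> bounded_measurable (f + g).
Proof.
move=> [rf mf [M fM]] [rg mg [N gN]]; split.
- rewrite (_ : (fun s => _) = (fun s => complex.Re (f s)) \+ (fun s => complex.Re (g s))).
    exact: measurable_funD.
  by apply/funext => s; rewrite /= /GRing.add /=; case: (f s) (g s) => ? ? [].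
- rewrite (_ : (fun s => _) = (fun s => complex.Im (f s)) \+ (fun s => complex.Im (g s))).
    exact: measurable_funD.
  by apply/funext => s; rewrite /= /GRing.add /=; case: (f s) (g s) => ? ? [].
- by exists (M + N) => s; rewrite (le_trans (ler_normD _ _))// lerD.
Qed.

Lemma bounded_measurableM (f g : S -> R[i]) :
  bounded_measurable f -> bounded_measurable g -> bounded_measurable (f * g).
Proof.
move=> [rf mf [M fM]] [rg mg [N gN]]; split.
- rewrite (_ : (fun s => _) = ((fun s => complex.Re (f s)) \* (fun s => complex.Re (g s))) \-
      ((fun s => complex.Im (f s)) \* (fun s => complex.Im (g s)))).
    by apply: measurable_funB; exact: measurable_funM.
  by apply/funext => s; rewrite /= /GRing.mul /=; case: (f s) (g s) => ? ? [].
- rewrite (_ : (fun s => _) = ((fun s => complex.Re (f s)) \* (fun s => complex.Im (g s))) \+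
      ((fun s => complex.Im (f s)) \* (fun s => complex.Re (g s)))).
    by apply: measurable_funD; exact: measurable_funM.
  by apply/funext => s; rewrite /= /GRing.mul /=; case: (f s) (g s) => ? ? [].
- exists (M * N) => s; rewrite [_ s](_ : _ = f s * g s)// normrM.
  by rewrite ler_pM.
Qed.

Lemma bounded_measurable_cst (c : R[i]) : bounded_measurable (cst c).
Proof.
split; [exact: measurable_cst|exact: measurable_cst|].
by exists `|c| => s /=.
Qed.

Lemma bounded_measurable_conj (f : S -> R[i]) :
  bounded_measurable f -> bounded_measurable (fun s => (f s)^*).
Proof.
move=> [rf mf [M fM]]; split.
- rewrite (_ : (fun s => _) = fun s => complex.Re (f s))//.
  by apply/funext => s /=; case: (f s).
- rewrite (_ : (fun s => _) = \- (fun s => complex.Im (f s))).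
    exact: measurable_funN.
  by apply/funext => s /=; case: (f s).
- by exists M => s; rewrite norm_conjC.
Qed.

Fact Linf_subring : subring_closed Linf_pred.
Proof.
split.
- by apply/asboolP; exact: bounded_measurable_cst.
- move=> f g /asboolP hf /asboolP hg; apply/asboolP.
  apply: bounded_measurableD => //; rewrite (_ : - g = cst (- 1) * g).
    by apply: bounded_measurableM => //; exact: bounded_measurable_cst.
  by apply/funext => s; rewrite [RHS]mulN1r.
- move=> f g /asboolP hf /asboolP hg; apply/asboolP.
  exact: bounded_measurableM.
Qed.

HB.instance Definition _ :=
  GRing.SubChoice_isSubComPzRing.Build _ _ Linf Linf_subring.

Fact Linf_submod : submod_closed Linf_pred.
Proof.
split; first by apply/asboolP; exact: (bounded_measurable_cst 0).
move=> k f g /asboolP hf /asboolP hg; apply/asboolP.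
apply: bounded_measurableD => //; rewrite (_ : k *: f = cst k * f)//.
by apply: bounded_measurableM => //; exact: bounded_measurable_cst.
Qed.

HB.instance Definition _ :=
  GRing.SubZmodule_isSubLmodule.Build R[i] (S -> R[i]) Linf_pred Linf
    (GRing.submod_closed_semi Linf_submod).

Fact Linf_neq0 : 1 != 0 :> Linf.
Proof.
apply/eqP => /(congr1 (fun f : Linf => f point)) /eqP.
by rewrite /= oner_eq0.
Qed.

HB.instance Definition _ := GRing.PzSemiRing_isNonZero.Build Linf Linf_neq0.

Fact Linf_scaleAl (k : R[i]) (f g : Linf) : k *: (f * g) = (k *: f) * g.
Proof. by apply: val_inj; apply/funext => s; rewrite /= [LHS]mulrA. Qed.

HB.instance Definition _ := GRing.Lmodule_isLalgebra.Build R[i] Linf Linf_scaleAl.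
HB.instance Definition _ := GRing.Lalgebra_isComAlgebra.Build R[i] Linf.

Definition Linf_star (f : Linf) : Linf :=
  MkLinf (introT (asboolP _) (bounded_measurable_conj (LinfP f))).

Fact Linf_starK : involutive Linf_star.
Proof. by move=> f; apply: val_inj; apply/funext => s /=; rewrite conjCK. Qed.
Fact Linf_starD : {morph Linf_star : f g / f + g}.
Proof.
by move=> f g; apply: val_inj; apply/funext => s /=; rewrite [LHS]rmorphD.
Qed.
Fact Linf_starM (f g : Linf) : Linf_star (f * g) = Linf_star g * Linf_star f.
Proof.
by apply: val_inj; apply/funext => s /=; rewrite [LHS]rmorphM [LHS]mulrC.
Qed.
Fact Linf_starZ (k : R[i]) (f : Linf) :
  Linf_star (k *: f) = k^* *: Linf_star f.
Proof. by apply: val_inj; apply/funext => s /=; rewrite [LHS]rmorphM. Qed.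

HB.instance Definition _ :=
  isStarAlg.Build R[i] Linf Linf_starK Linf_starD Linf_starM Linf_starZ.

End Linf.

Arguments Linf R {d} S.

Section StarAlgebras.
Variables (K : numClosedFieldType).
Implicit Types A B : comStarAlgType K.

Definition is_state A (P : A -> K) : Prop :=
  [/\ forall (k : K) (x y : A), P (k *: x + y) = k * P x + P y,
      P 1 = 1 & forall a : A, 0 <= P (star a * a)].

Definition is_subalgebra A (C : set A) : Prop :=
  [/\ C 1, forall (k : K) (x y : A), C x -> C y -> C (k *: x + y) &
      forall x y : A, C x -> C y -> C (x * y)].

Definition generated_subalgebra A (G : set A) : set A :=
  smallest (@is_subalgebra A) G.

Definition star_mx A m n (X : 'M[A]_(m, n)) : 'M[A]_(n, m) := map_mx star X^T.

(* A Markov operator from the *-subalgebra C to the *-subalgebra D. A positive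
   element of the *-algebra of n x n matrices over C is a finite sum of elements
   Y^* Y, that is, X^* X for a rectangular X. *)
Definition is_markov A B (C : set A) (D : set B) (T : A -> B) : Prop :=
  [/\ forall a, C a -> D (T a),
      forall (k : K) (x y : A), C x -> C y -> T (k *: x + y) = k *: T x + T y,
      T 1 = 1 &
      forall m n (X : 'M[A]_(m, n)), (forall i j, C (X i j)) ->
        exists p (Y : 'M[B]_(p, n)), (forall i j, D (Y i j)) /\
          map_mx T (star_mx X *m X) = star_mx Y *m Y].

(* [e] is a version of the P-conditional expectation of [a] onto C. *)
Definition is_condexp A (P : A -> K) (C : set A) (a e : A) : Prop :=
  C e /\ forall c, C c -> P (a * c) = P (e * c).

Definition null A (P : A -> K) (c : A) : Prop := P (star c * c) = 0.

End StarAlgebras.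

Section HiddenProcess.
Variables (R : realType) (dH dO : nat -> measure_display).
Variables (SH : forall n, measurableType (dH n)).
Variables (SO : forall n, measurableType (dO n)).

Definition H_at n : comStarAlgType R[i] := Linf R (SH n).
Definition O_at n : comStarAlgType R[i] := Linf R (SO n).

(* The tensor product of two algebras is indexed by [bool]: [true] is the hidden
   factor, [false] the observed one. *)
Definition HO_factors n (b : bool) : comStarAlgType R[i] :=
  if b then H_at n else O_at n.

Definition HO_at n : comStarAlgType R[i] := tensor (HO_factors n).

Definition alg_HO : comStarAlgType R[i] := tensor HO_at.

Definition alg_H : comStarAlgType R[i] := tensor H_at.
Definition alg_O : comStarAlgType R[i] := tensor O_at.

Definition inH n (g : Linf R (SH n)) : alg_H := @tin _ _ H_at n g.
Definition inO n (f : Linf R (SO n)) : alg_O := @tin _ _ O_at n f.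

Definition factorH n (g : Linf R (SH n)) : HO_at n :=
  @tin _ _ (HO_factors n) true g.
Definition factorO n (f : Linf R (SO n)) : HO_at n :=
  @tin _ _ (HO_factors n) false f.

Lemma factorH1 n : factorH (1 : Linf R (SH n)) = 1.
Proof. exact: (@tin1 _ _ (HO_factors n) true). Qed.

Definition jH n (g : Linf R (SH n)) : alg_HO := @tin _ _ HO_at n (factorH g).
Definition jO n (f : Linf R (SO n)) : alg_HO := @tin _ _ HO_at n (factorO f).

(* The identification of [alg_H] with the *-subalgebra of [alg_HO] generated by
   the hidden process: the tensor product of the maps g |-> g (x) 1. *)
Definition embH : alg_H -> alg_HO := @tmap _ _ H_at HO_at factorH factorH1.

Definition range_H n : set alg_HO := range (@jH n).
Definition range_O n : set alg_HO := range (@jO n).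

Definition range_H_upto n : set alg_HO :=
  generated_subalgebra [set a | exists2 m, (m <= n)%N & range_H m a].

(* [T] is a Markov operator giving the restriction of the conditional expectation
   onto A_{H_m} to A_{O_m}. *)
Definition is_restricted_condexp (P : alg_HO -> R[i]) m
    (T : alg_HO -> alg_HO) : Prop :=
  is_markov (range_O m) (range_H m) T /\
  forall a, range_O m a -> is_condexp P (range_H m) a (T a).

Definition is_hidden_process (P : alg_HO -> R[i]) : Prop :=
  [/\ is_state P,
      forall m, exists T, is_restricted_condexp P m T,
      forall n (f : forall m, Linf R (SO m)),
        exists e, is_condexp P (range_H_upto n) (\prod_(m < n.+1) jO (f m)) e &
      forall n (f : forall m, Linf R (SO m)) e (e_ : nat -> alg_HO),
        is_condexp P (range_H_upto n) (\prod_(m < n.+1) jO (f m)) e ->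
        (forall m, (m <= n)%N ->
          is_condexp P (range_H m) (jO (f m)) (e_ m)) ->
        null P (e - \prod_(m < n.+1) e_ m)].

(* [B] is a version of the m-th emission operator: since [jH] is injective,
   B = jH^-1 o T o jO. *)
Definition is_emission (P : alg_HO -> R[i]) m
    (B : Linf R (SO m) -> Linf R (SH m)) : Prop :=
  exists2 T, is_restricted_condexp P m T & forall f, jH (B f) = T (jO f).

Definition joint_expectations (P : alg_HO -> R[i]) (PH : alg_H -> R[i])
    (B : forall m, Linf R (SO m) -> Linf R (SH m)) : Prop :=
  forall n (f : forall m, Linf R (SO m)) (g : forall m, Linf R (SH m)),
    P (\prod_(m < n.+1) (jO (f m) * jH (g m))) =
    PH (\prod_(m < n.+1) inH (B m (f m) * g m)).

(* The observed process has the joint expectations prescribed by [P]. *)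
Definition has_observed_process (P : alg_HO -> R[i]) (PO : alg_O -> R[i]) : Prop :=
  is_state PO /\ forall n (f : forall m, Linf R (SO m)),
    PO (\prod_(m < n.+1) inO (f m)) = P (\prod_(m < n.+1) jO (f m)).

End HiddenProcess.

(* Main.v *)
(* The map T : A_{H,O} -> A_H that tensors the maps g (x) f |-> g * B_n f is a
   unital A_H-linear retraction onto A_H, and the identity to be proved says
   that P_{H,O} = P_H o T. Each factor of T is completely positive, hence so is
   T, because Hadamard products of Gram kernels are Gram kernels; so P_H o T is
   a state. Linearity over A_H makes T the conditional expectation onto A_H,
   which yields the hidden process property. Uniqueness holds because the
   products of elements f(O_m) g(H_m) span A_{H,O}. In the direct part the
   conditional expectation of prod f_m(O_m) differs from prod (B_m f_m)(H_m) by
   a null element, and by Cauchy-Schwarz the null elements form an ideal on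
   which P vanishes. *)
From HB Require Import structures.
Require Import Defs.
From mathcomp Require Import all_boot all_order all_algebra.
From mathcomp Require Import all_classical all_reals all_analysis.
From mathcomp Require Import complex.

Set Implicit Arguments.
Unset Strict Implicit.
Unset Printing Implicit Defensive.

Import Order.TTheory GRing.Theory Num.Theory.

Local Open Scope classical_set_scope.
Local Open Scope ring_scope.

(** * Linear maps given as bare functions *)

Section LinearMaps.
Variables (K : numClosedFieldType) (U V : lmodType K) (f : U -> V).
Hypothesis fL : linear f.

Let g : {linear U -> V} := HB.pack f (GRing.isLinear.Build K U V *:%R f fL).

Lemma lin0 : f 0 = 0. Proof. exact: (linear0 g). Qed.
Lemma linD x y : f (x + y) = f x + f y. Proof. exact: (linearD g). Qed.
Lemma linB x y : f (x - y) = f x - f y. Proof. exact: (linearB g). Qed.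
Lemma linZ k x : f (k *: x) = k *: f x. Proof. exact: (linearZ_LR g). Qed.
Lemma lin_sum J (r : seq J) (F : J -> U) :
  f (\sum_(i <- r) F i) = \sum_(i <- r) f (F i).
Proof. exact: (linear_sum g). Qed.

End LinearMaps.

(** * Homomorphisms, Gram kernels and completely positive maps of commutative star-algebras *)

Section StarAlgebra.
Variable K : numClosedFieldType.
Implicit Types A B : comStarAlgType K.

Lemma star0 A : star (0 : A) = 0.
Proof. by rewrite -[in LHS](scale0r (1 : A)) starZ conjC0 scale0r. Qed.

Lemma star_sum A J (r : seq J) (F : J -> A) :
  star (\sum_(i <- r) F i) = \sum_(i <- r) star (F i).
Proof. exact: (big_morph _ (@starD K A) (star0 A)). Qed.

Definition star_hom A B (phi : A -> B) : Prop :=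
  [/\ linear phi, forall x y, phi (x * y) = phi x * phi y, phi 1 = 1 &
      forall x, phi (star x) = star (phi x)].

Lemma star_hom_prod A B (phi : A -> B) J (r : seq J) (F : J -> A) :
  star_hom phi -> phi (\prod_(i <- r) F i) = \prod_(i <- r) phi (F i).
Proof. by case=> _ phiM phi1 _; exact: (big_morph _ phiM phi1). Qed.

Lemma star_hom_comp A B (C : comStarAlgType K) (phi : A -> B) (psi : B -> C) :
  star_hom phi -> star_hom psi -> star_hom (psi \o phi).
Proof.
move=> [pL pM p1 ps] [qL qM q1 qs]; split=> [k x y|x y||x] /=.
- by rewrite pL qL.
- by rewrite pM qM.
- by rewrite p1.
- by rewrite ps.
Qed.

Lemma star_hom_mx A B (phi : A -> B) m n (X : 'M[A]_(m, n)) : star_hom phi ->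
  map_mx phi (star_mx X *m X) = star_mx (map_mx phi X) *m map_mx phi X.
Proof.
case=> phiL phiM _ phis; apply/matrixP => i j; rewrite !mxE (lin_sum phiL).
by apply: eq_bigr => k _; rewrite !mxE phiM phis.
Qed.

(* The kernel [M] on the indices [s] is positive: it is [Y^* Y] for a matrix [Y]
   whose rows are the members of a sequence of functions. *)
Definition gram (N : eqType) A (s : seq N) (M : N -> N -> A) : Prop :=
  exists Y : seq (N -> A),
    {in s &, forall a b, M a b = \sum_(y <- Y) star (y a) * y b}.

Lemma eq_gram (N : eqType) A (s : seq N) (M M' : N -> N -> A) :
  {in s &, M =2 M'} -> gram s M -> gram s M'.
Proof. by move=> MM [Y YM]; exists Y => a b sa sb; rewrite -MM// YM. Qed.

Lemma gram_hom (N : eqType) A (s : seq N) (c : N -> A) :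
  gram s (fun a b => star (c a) * c b).
Proof. by exists [:: c] => a b _ _; rewrite big_seq1. Qed.

(** Rows are multiplied pairwise: the functions [y a * z a] are the rows for the entrywise product.
    Commutativity of [A] regroups the factors. *)
Lemma gramM (N : eqType) A (s : seq N) (M M' : N -> N -> A) :
  gram s M -> gram s M' -> gram s (fun a b => M a b * M' a b).
Proof.
move=> [Y MY] [Z MZ]; exists [seq (fun a => y a * z a) | y <- Y, z <- Z].
move=> a b sa sb; rewrite MY// MZ// big_allpairs_dep mulr_suml.
apply: eq_bigr => y _; rewrite mulr_sumr; apply: eq_bigr => z _.
by rewrite starM mulrACA [star (y a) * _]mulrC.
Qed.

Lemma gram_prod (N : eqType) A (s : seq N) J (r : seq J)
    (M : J -> N -> N -> A) :
  (forall i, gram s (M i)) -> gram s (fun a b => \prod_(i <- r) M i a b).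
Proof.
move=> MG; elim: r => [|i r ih].
  apply: eq_gram (gram_hom s (fun=> 1)) => a b _ _.
  by rewrite star1 mulr1 big_nil.
by apply: eq_gram (gramM (MG i) ih) => a b _ _; rewrite big_cons.
Qed.

Lemma gram_star_hom (N : eqType) A B (phi : A -> B) (s : seq N)
    (M : N -> N -> A) :
  star_hom phi -> gram s M -> gram s (fun a b => phi (M a b)).
Proof.
move=> [phiL phiM _ phis] [Y MY]; exists [seq phi \o y | y <- Y] => a b sa sb.
rewrite MY// (lin_sum phiL) big_map.
by apply: eq_bigr => y _; rewrite phiM phis.
Qed.

Lemma gram_map (N N' : eqType) A (h : N -> N') (s : seq N)
    (M : N' -> N' -> A) :
  gram (map h s) M -> gram s (fun a b => M (h a) (h b)).
Proof.
move=> [Y MY]; exists [seq y \o h | y <- Y] => a b sa sb.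
by rewrite MY ?map_f// big_map.
Qed.

(** The entries of a one-row matrix [X] serve as their own indices, so this is the matrix condition
    of [is_markov] for such [X]. Every [star_mx X *m X] is a sum of matrices of this kind. *)
Definition completely_positive A B (T : A -> B) : Prop :=
  forall s : seq A, gram s (fun a b => T (star a * b)).

Lemma markov_completely_positive A B (T : A -> B) :
  is_markov [set: A] [set: B] T -> completely_positive T.
Proof.
(* The elements of [s] form a single row, so [star_mx X *m X] is the kernel on them. *)
move=> [_ _ _ Tcp] s; pose X := \matrix_(i < 1, j < size s) s`_j.
have [|p [Y [_ XY]]] := Tcp _ _ X; first by [].
(* Row [i] of [Y] becomes a function on [A] through the first position of [a] in [s]; the default 0
   is only taken outside [s]. *)
exists [seq (fun a => if insub (index a s) is Some j then Y i j else 0)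
       | i <- enum 'I_p] => a b sa sb.
rewrite big_map big_enum /=.
move: (sa) (sb); rewrite -!index_mem => ia ib.
rewrite (insubT (fun j => j < size s)%N ia) (insubT (fun j => j < size s)%N ib).
have := congr1 (fun Z : 'M[B]_(size s) => Z (Ordinal ia) (Ordinal ib)) XY.
rewrite !mxE big_ord1 !mxE /= !nth_index// => ->.
by apply: eq_bigr => i _; rewrite !mxE.
Qed.

Lemma state_completely_positive A B (T : A -> B) (P : B -> K) :
  is_state P -> linear T -> T 1 = 1 -> completely_positive T ->
  is_state (P \o T).
Proof.
move=> [PL P1 Ppos] TL T1 Tcp; split=> /=.
- by move=> k x y; rewrite TL PL.
- by rewrite T1.
(* The kernel on the single index [a] is a sum of terms [star y * y], on each of which [P] is
   nonnegative. *)
- move=> a; have [Y YE] := Tcp [:: a]; rewrite YE ?mem_head//.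
  have -> := @lin_sum K B K^o P PL _ Y.
  by apply: sumr_ge0 => y _; exact: Ppos.
Qed.

(** * Null elements of a state and uniqueness of conditional expectations *)

Section State.
Variables (A : comStarAlgType K) (P : A -> K).
Hypothesis Pst : is_state P.

Let PL : linear (P : A -> K^o).
Proof. by case: Pst. Qed.

(* Cauchy-Schwarz: [P (star (y + t d) (y + t d))] is affine in [t] and [t^*], so
   its positivity for all [t] kills the linear part. *)
Lemma null_mul d x : null P d -> P (x * d) = 0.
Proof.
move=> dn; pose y := star x.
pose q := P (star y * d); pose r := P (star d * y); pose p := P (star y * y).
have [_ _ Ppos] := Pst.
have pos t : 0 <= p + (t * q + t^* * r).
  have := Ppos (y + t *: d); rewrite starD starZ mulrDl !mulrDr.
  rewrite -!scalerAl -!scalerAr !(linD PL) !(linZ PL).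
  by rewrite [P (star d * d)]dn !scaler0 addr0 addrA.
have lin t : t * q + t^* * r = 0.
  set u := _ + _; apply: contrapT => /eqP u0.
  have p0 : 0 <= p := Ppos y.
  (* [u] is the difference of the real numbers [p + u] and [p]. *)
  have ur : u \is Num.real.
    have := ger0_real (pos t); rewrite -/u => h.
    by rewrite -[u](addKr p) rpredD// rpredN ger0_real.
  (* The real factor [s] is chosen so that replacing [t] by [s * t] gives the value p - (p + 1) =
     -1. *)
  pose s : K := - (p + 1) / u.
  have sr : s \is Num.real.
    by rewrite rpredM ?rpredV// rpredN rpredD ?rpred1 ?ger0_real.
  have := pos (s * t); rewrite rmorphM /= (CrealP sr) -!(mulrA s) -mulrDr -/u.
  by rewrite mulfVK// opprD addrA subrr add0r oppr_ge0 ler10.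
(* The values 1 and ['i] of [t] give q + r = 0 and q = r. *)
have := lin 1; rewrite conjC1 !mul1r => qr.
have := lin 'i; rewrite conjCi mulNr -mulrBr => /eqP.
rewrite mulf_eq0 (negPf (neq0Ci K)) /= subr_eq0 => /eqP qr'.
have /eqP : q *+ 2 = 0 by rewrite mulr2n {2}qr'.
by rewrite mulrn_eq0 /= => /eqP; rewrite /q /y starK.
Qed.

(** Replaces a quadratic condition by a linear one, which makes the ideal properties immediate. *)
Lemma nullP d : null P d <-> forall x, P (x * d) = 0.
Proof. by split=> [dn x|]; [exact: null_mul|exact]. Qed.

Lemma nullD d e : null P d -> null P e -> null P (d + e).
Proof.
move=> /nullP dn /nullP en; apply/nullP => x.
by rewrite mulrDr (linD PL) dn en addr0.
Qed.

Lemma nullM x d : null P d -> null P (x * d).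
Proof. by move=> /nullP dn; apply/nullP => y; rewrite mulrA dn. Qed.

(** Telescoping: one factor is exchanged at a time, and each exchange costs a multiple of a null
    element. *)
Lemma null_prod J (r : seq J) (F G : J -> A) :
  (forall i, null P (F i - G i)) ->
  null P (\prod_(i <- r) F i - \prod_(i <- r) G i).
Proof.
move=> FG; elim: r => [|i r ih].
  by apply/nullP => x; rewrite !big_nil subrr mulr0 (lin0 PL).
rewrite !big_cons (_ : _ - _ = F i * (\prod_(j <- r) F j - \prod_(j <- r) G j)
  + (\prod_(j <- r) G j) * (F i - G i)).
  by apply: nullD; apply: nullM.
by rewrite !mulrBr addrA [_ * F i]mulrC [_ * G i]mulrC subrK.
Qed.

(** The difference of the two versions lies in [C], so its own star may be used as the test
    element. *)
Lemma condexp_unique (C : set A) a e e' :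
  (forall k x y, C x -> C y -> C (k *: x + y)) ->
  (forall x, C x -> C (star x)) ->
  is_condexp P C a e -> is_condexp P C a e' -> null P (e - e').
Proof.
move=> CL Cs [Ce eE] [Ce' eE'].
have Cd : C (e - e') by rewrite addrC -scaleN1r; exact: CL.
rewrite /null mulrC mulrBl (linB PL) -eE -?eE' ?subrr//; exact: Cs.
Qed.

End State.

(** * Generated subalgebras and linear spans *)

Lemma generated_is_subalgebra A (G : set A) :
  is_subalgebra (generated_subalgebra G).
Proof.
split.
- by move=> C [[]].
- move=> k x y Cx Cy C CG; have [_ CL _] := CG.1.
  by apply: CL; [exact: Cx|exact: Cy].
- move=> x y Cx Cy C CG; have [_ _ CM] := CG.1.
  by apply: CM; [exact: Cx|exact: Cy].
Qed.

Lemma sub_generated A (G : set A) : G `<=` generated_subalgebra G.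
Proof. exact: sub_smallest. Qed.

Lemma generated_min A (G C : set A) :
  is_subalgebra C -> G `<=` C -> generated_subalgebra G `<=` C.
Proof. by move=> Csub GC x; apply. Qed.

(** The elements whose star is generated form a subalgebra containing [G], so minimality applies. *)
Lemma generated_star A (G : set A) : (forall x, G x -> G (star x)) ->
  forall x, generated_subalgebra G x -> generated_subalgebra G (star x).
Proof.
move=> Gs; have [C1 CL CM] := generated_is_subalgebra G.
apply: (@generated_min A G (fun x => generated_subalgebra G (star x))).
  split; first by rewrite star1.
    by move=> k x y Cx Cy; rewrite starD starZ; exact: CL.
  by move=> x y Cx Cy; rewrite starM; exact: CM.
by move=> x /Gs; exact: sub_generated.
Qed.

Lemma subalgebra_prod A (C : set A) J (r : seq J) (Q : pred J) (F : J -> A) :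
  is_subalgebra C -> (forall i, Q i -> C (F i)) -> C (\prod_(i <- r | Q i) F i).
Proof. by move=> [C1 _ CM] CF; elim/big_rec: _ => // i x /CF; exact: CM. Qed.

(** Combinations are built one term at a time, so linear identities follow by induction. *)
Inductive lspan A (G : set A) : A -> Prop :=
| lspan0 : lspan G 0
| lspanD k g x : G g -> lspan G x -> lspan G (k *: g + x).

(** The span of a multiplicative set containing 1 is already a subalgebra. *)
Lemma lspan_generated A (G : set A) : G 1 ->
  (forall x y, G x -> G y -> G (x * y)) ->
  generated_subalgebra G `<=` lspan G.
Proof.
move=> G1 GM.
have GL : G `<=` lspan G.
  move=> g Gg; rewrite -[g]scale1r -[_ *: _]addr0.
  by apply: lspanD => //; exact: lspan0.
have LZD k x y : lspan G x -> lspan G y -> lspan G (k *: x + y).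
  move=> Lx Ly; elim: Lx => {x} [|l g x Gg _ ih]; first by rewrite scaler0 add0r.
  by rewrite scalerDr scalerA -addrA; exact: lspanD.
have LG g x : G g -> lspan G x -> lspan G (g * x).
  move=> Gg; elim=> {x} [|l h x Gh _ ih]; first by rewrite mulr0; exact: lspan0.
  by rewrite mulrDr -scalerAr; apply: lspanD => //; exact: GM.
apply: generated_min => //; split; [exact: GL|exact: LZD|].
move=> x y Lx Ly; elim: Lx => {x} [|l g x Gg _ ih].
  by rewrite mul0r; exact: lspan0.
by rewrite mulrDl -scalerAl; apply: LZD => //; exact: LG.
Qed.

Lemma eq_on_generated A (V : lmodType K) (G : set A) (f g : A -> V) :
  linear f -> linear g -> G 1 -> (forall x y, G x -> G y -> G (x * y)) ->
  (forall x, G x -> f x = g x) ->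
  forall x, generated_subalgebra G x -> f x = g x.
Proof.
move=> fL gL G1 GM fg x /(lspan_generated G1 GM); elim=> {x}.
  by rewrite (lin0 fL) (lin0 gL).
by move=> k h x Gh _ ih; rewrite fL gL ih fg.
Qed.

End StarAlgebra.

(** * Universal property, generators and positivity for tensor products *)

Section TensorAlgebra.
Variables (K : numClosedFieldType) (I : choiceType) (A : I -> comStarAlgType K).

Lemma tcl_pure k (a : fam A) : tcl [:: (k, a)] = k *: tpure a.
Proof. by rewrite scale_tcl1 mulr1. Qed.

Lemma tensor_sum_pure (x : tensor A) :
  x = \sum_(p <- trepr x) p.1 *: tpure p.2.
Proof.
rewrite -[LHS]treprK; elim: (trepr x) => [|[k a] s ih]; first by rewrite big_nil.
by rewrite tcl_cons ih big_cons tcl_pure.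
Qed.

Lemma tpureM (a b : fam A) : tpure a * tpure b = tpure (famM a b).
Proof. by rewrite [LHS]tmul1 mulr1. Qed.

Lemma star_tpure (a : fam A) : star (tpure a) = tpure (fam_star a).
Proof. by rewrite [LHS]tstar1 conjC1. Qed.

Lemma tensor_linear_eq (V : lmodType K) (f g : tensor A -> V) :
  linear f -> linear g -> (forall a, f (tpure a) = g (tpure a)) -> f =1 g.
Proof.
move=> fL gL fg; elim/tensor_ind => [|k a x ih].
  by rewrite (lin0 fL) (lin0 gL).
by rewrite tcl_pure fL gL fg ih.
Qed.

(** Linearity in slot [i] is stated for families agreeing elsewhere, to match the relations
    [teq_slotZ] and [teq_slotD]. *)
Definition multilinear (V : lmodType K) (F : fam A -> V) : Prop :=
  (forall i l (a b : fam A), (forall j, j != i -> a j = b j) ->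
     a i = l *: b i -> F a = l *: F b) /\
  (forall i (a b c : fam A), (forall j, j != i -> a j = b j /\ a j = c j) ->
     a i = b i + c i -> F a = F b + F c).

(** The extension given by the universal property; it is linear once [F] is multilinear. *)
Definition tlift (V : lmodType K) (F : fam A -> V) : tensor A -> V :=
  tfold (fun k a => k *: F a).

Section Lift.
Variables (V : lmodType K) (F : fam A -> V).
Hypothesis Fml : multilinear F.

Lemma tlift_compat : tcompat (fun k a => k *: F a).
Proof.
have [FZ FD] := Fml; split.
- by move=> a; rewrite scale0r.
- by move=> k l a; rewrite scalerDl.
- by move=> i k l a b ab abi; rewrite (FZ i l a b)// scalerA.
- by move=> i k a b c abc abci; rewrite (FD i a b c)// scalerDr.
Qed.

Lemma tlift_pure a : tlift F (tpure a) = F a.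
Proof. by rewrite /tlift tfold1 ?scale1r//; exact: tlift_compat. Qed.

Lemma tlift_linear : linear (tlift F).
Proof.
move=> k x y; rewrite /tlift tfoldD; last exact: tlift_compat.
congr (_ + _); elim/tensor_ind: x => [|l a x ih].
  by rewrite scaler0 (tfold_tcl [::] tlift_compat) big_nil scaler0.
rewrite scalerDr !tfoldD; do ?exact: tlift_compat.
by rewrite ih scale_tcl1 !tfold1 ?scalerDr ?scalerA//; exact: tlift_compat.
Qed.

End Lift.

Lemma tpure_multilinear : multilinear (@tpure K I A).
Proof.
split=> [i l a b ab abi|i a b c abc abci].
  rewrite -tcl_pure -[l]mul1r; apply/tclP; exact: teq_slotZ abi.
by rewrite -tclD; apply/tclP; exact: teq_slotD abci.
Qed.

Lemma tin_star_hom i : star_hom (@tin K I A i).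
Proof.
have [tZ tD] := tpure_multilinear.
have eq_fam_at (x y : A i) j : j != i -> fam_at x j = fam_at y j.
  by move=> ji; rewrite /= !eqtype.dfwith_out// eq_sym.
split=> [k x y|x y||x].
- rewrite /tin (tD i _ (fam_at (k *: x)) (fam_at y)) /=.
  + rewrite (tZ i k (fam_at (k *: x)) (fam_at x))//=.
      by move=> j; exact: eq_fam_at.
    by rewrite !eqtype.dfwith_in.
  + by move=> j ji; split; exact: eq_fam_at.
  + by rewrite !eqtype.dfwith_in.
- rewrite /tin tpureM; congr tpure; apply: fam_ext => j /=.
  have [<-|ij] := eqVneq i j; first by rewrite !eqtype.dfwith_in.
  by rewrite !eqtype.dfwith_out// mulr1.
- exact: tin1.
- rewrite /tin star_tpure; congr tpure; apply: fam_ext => j /=.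
  have [<-|ij] := eqVneq i j; first by rewrite !eqtype.dfwith_in.
  by rewrite !eqtype.dfwith_out// star1.
Qed.

Program Definition fam_on (r : seq I) (x : forall i, A i) : fam A :=
  @Fam K I A (fun i => if i \in r then x i else 1) _.
Next Obligation.
move=> r x; apply: sub_finite_set (finite_seq r) => i /=.
by case: ifP.
Qed.

Lemma prod_tin (r : seq I) (x : forall i, A i) : uniq r ->
  \prod_(i <- r) tin i (x i) = tpure (fam_on r x).
Proof.
elim: r => [_|i r ih /= /andP[ir ur]].
  by rewrite big_nil; congr tpure; apply: fam_ext.
rewrite big_cons ih// /tin tpureM; congr tpure; apply: fam_ext => j /=.
rewrite inE; have [->|ji] := eqVneq j i.
  by rewrite eqtype.dfwith_in (negPf ir) mulr1.
by rewrite eqtype.dfwith_out ?mul1r// eq_sym.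
Qed.

(** One list of indices serves all of [s]: the union of the finite supports. Kernels of pure tensors
    thus become products over a common list. *)
Lemma tpure_prod (s : seq (fam A)) :
  exists2 r : seq I, uniq r &
    {in s, forall a : fam A, tpure a = \prod_(i <- r) tin i (a i)}.
Proof.
suff [r ur rs] : exists2 r : seq I, uniq r &
    {in s, forall (a : fam A) i, i \notin r -> a i = 1}.
  exists r => // a sa; rewrite prod_tin//; congr tpure; apply: fam_ext => i /=.
  by case: ifPn => // /(rs a sa).
elim: s => [|a s [r ur rs]]; first by exists [::].
have [t at_] := (finite_seqP _).1 (fam_fin a).
exists (undup (r ++ t)) => [|b]; first exact: undup_uniq.
rewrite inE => bs i; rewrite mem_undup mem_cat negb_or => /andP[ir it_].
case/orP: bs => [/eqP ->|/rs]; last exact.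
apply: contrapT => ai1; case/negP: it_.
have : [set i | a i <> 1] i by [].
by rewrite at_.
Qed.

Lemma tensor_generated (C : set (tensor A)) :
  is_subalgebra C -> (forall i x, C (tin i x)) -> forall x, C x.
Proof.
move=> Csub Ctin x; have [C1 CL _] := Csub.
elim/tensor_ind: x => [|k a x ih].
  (* Zero is reached as -1 + 1. *)
  by have := CL (-1) _ _ C1 C1; rewrite scaleN1r addNr.
rewrite tcl_pure; apply: CL => //.
have [r _ ra] := tpure_prod [:: a].
by rewrite ra ?mem_head//; apply: subalgebra_prod.
Qed.

(** Pure tensors suffice by sesquilinear expansion: a row [y] on families extends to tensors through
    their chosen representatives. The list [t] collects all families occurring in these. *)
Lemma tensor_completely_positive (B : comStarAlgType K) (T : tensor A -> B) :
  linear T ->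
  (forall s : seq (fam A), gram s (fun a b => T (tpure (famM (fam_star a) b)))) ->
  completely_positive T.
Proof.
move=> TL Tgram s; pose t := flatten [seq unzip2 (trepr x) | x <- s].
have [Y YE] := Tgram t.
exists [seq (fun x => \sum_(p <- trepr x) p.1 *: y p.2) | y <- Y] => x z sx sz.
have mem_t w p : w \in s -> p \in trepr w -> p.2 \in t.
  move=> sw pw; apply/flatten_mapP; exists w => //; exact: map_f.
rewrite big_map {1}[x]tensor_sum_pure {1}[z]tensor_sum_pure.
rewrite star_sum mulr_suml (lin_sum TL).
under [RHS]eq_bigr do rewrite star_sum mulr_suml.
rewrite exchange_big /=; apply: eq_big_seq => p px.
rewrite mulr_sumr (lin_sum TL).
under [RHS]eq_bigr do rewrite mulr_sumr.
rewrite exchange_big /=; apply: eq_big_seq => q qz.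
rewrite starZ star_tpure -scalerAl -scalerAr tpureM !(linZ TL).
rewrite (YE _ _ (mem_t _ _ sx px) (mem_t _ _ sz qz)) !scaler_sumr.
apply: eq_bigr => y _.
by rewrite starZ -scalerAl -scalerAr.
Qed.

End TensorAlgebra.

(** * Tensor products of linear unital maps *)

Section TensorMaps.
Variables (K : numClosedFieldType) (I : choiceType).
Variables (A B : I -> comStarAlgType K) (h : forall i, A i -> B i).
Arguments h : clear implicits.
Hypothesis (h1 : forall i, h i (1 : A i) = 1) (hL : forall i, linear (h i)).

Lemma tmap_multilinear : multilinear (fun a => tpure (fam_map h1 a)).
Proof.
have [tZ tD] := tpure_multilinear B.
split=> [i l a b ab abi|i a b c abc abci].
  by apply: (tZ i) => [j /ab /= ->//|] /=; rewrite abi (linZ (@hL i)).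
apply: (tD i) => [j /abc /= [ab ac]|] /=; first by rewrite -ab -ac.
by rewrite abci (linD (@hL i)).
Qed.

Lemma tmap_linear : linear (tmap h1).
Proof. exact: tlift_linear tmap_multilinear. Qed.

Lemma tmap_tpure a : tmap h1 (tpure a) = tpure (fam_map h1 a).
Proof. exact: tlift_pure tmap_multilinear _. Qed.

Lemma tmap_prod_tin (r : seq I) (x : forall i, A i) : uniq r ->
  tmap h1 (\prod_(i <- r) tin i (x i)) = \prod_(i <- r) tin i (h i (x i)).
Proof.
move=> ur; rewrite !prod_tin// tmap_tpure; congr tpure; apply: fam_ext => i /=.
by case: ifP.
Qed.

Lemma tmap_tin i x : tmap h1 (tin i x) = tin i (h i x).
Proof.
rewrite [LHS]tmap_tpure; congr tpure; apply: fam_ext => j /=.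
have [<-|ij] := eqVneq i j; first by rewrite !eqtype.dfwith_in.
by rewrite !eqtype.dfwith_out.
Qed.

Lemma tmap1 : tmap h1 1 = 1.
Proof. by rewrite [LHS]tmap_tpure; congr tpure; apply: fam_ext => i /=. Qed.

Lemma tmap_star_hom :
  (forall i, star_hom (h i)) -> star_hom (tmap h1).
Proof.
move=> hs; have tL := tmap_linear; split=> [//|x y||x].
- elim/tensor_ind: x => [|k a x ih]; first by rewrite mul0r (lin0 tL) mul0r.
  rewrite mulrDl !(linD tL) mulrDl ih; congr (_ + _).
  elim/tensor_ind: y {ih} => [|l b y ih]; first by rewrite mulr0 (lin0 tL) mulr0.
  rewrite mulrDr !(linD tL) mulrDr ih; congr (_ + _); rewrite !tcl_pure.
  rewrite -scalerAl -scalerAr !(linZ tL) -scalerAl -scalerAr tpureM !tmap_tpure.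
  rewrite tpureM; congr (_ *: (_ *: tpure _)); apply: fam_ext => i /=.
  by case: (hs i).
- exact: tmap1.
- elim/tensor_ind: x => [|k a x ih]; first by rewrite star0 (lin0 tL) star0.
  rewrite starD !(linD tL) starD ih; congr (_ + _); rewrite !tcl_pure.
  rewrite starZ !(linZ tL) starZ star_tpure !tmap_tpure star_tpure.
  congr (_ *: tpure _); apply: fam_ext => i /=.
  by case: (hs i).
Qed.

(* Factorwise, the kernel of a completely positive map is a Gram kernel, and the
   kernel of the tensor product is the entrywise product of their images. *)
Lemma tmap_completely_positive :
  (forall i, completely_positive (h i)) -> completely_positive (tmap h1).
Proof.
move=> hcp; apply: tensor_completely_positive tmap_linear _ => s.
have [r ur rs] := tpure_prod [seq famM (fam_star a) b | a <- s, b <- s].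
pose M i (a b : fam A) := tin i (h i (star (a i) * b i)).
have MG i : gram s (M i).
  apply: gram_star_hom (tin_star_hom B i) _.
  exact: (gram_map (h := fun a : fam A => a i) (hcp i _)).
apply: eq_gram (gram_prod r MG) => a b sa sb.
rewrite rs; last by apply/allpairsP; exists (a, b).
by rewrite (tmap_prod_tin (famM (fam_star a) b)).
Qed.

End TensorMaps.

(** * Tensor products indexed by the natural numbers *)

Section SequenceTensor.
Variables (K : numClosedFieldType) (A : nat -> comStarAlgType K).

Lemma tmap_prod_ord (B : nat -> comStarAlgType K) (h : forall m, A m -> B m)
    (h1 : forall m, h m (1 : A m) = 1) n (x : forall m, A m) :
  (forall m, linear (h m)) ->
  tmap h1 (\prod_(m < n) tin (A := A) m (x m)) =
  \prod_(m < n) tin (A := B) m (h m (x m)).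
Proof.
move=> hL; rewrite -(big_mkord xpredT (fun m => tin (A := A) m (x m))).
by rewrite (tmap_prod_tin h1 hL) ?iota_uniq// big_mkord.
Qed.

(** Padding with units brings two initial products to the same length before they are multiplied. *)
Lemma prod_tin_widen n N (x : forall m, A m) : (n <= N)%N ->
  \prod_(m < n) tin (A := A) m (x m) =
  \prod_(m < N) tin (A := A) m (if (m < n)%N then x m else 1).
Proof.
move=> nN; rewrite (big_ord_widen N (fun m => tin (A := A) m (x m)))//.
rewrite big_mkcond /=; by apply: eq_bigr => m _; case: ifP => // _; rewrite tin1.
Qed.

(** The initial products [E] form a multiplicative set, so agreement on [E] extends to the algebra
    it generates. That algebra contains every single factor, since [G m] generates [A m], hence the
    whole tensor product. *)
Lemma eq_on_products (V : lmodType K) (f g : tensor A -> V)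
    (G : forall m, set (A m)) :
  linear f -> linear g ->
  (forall m, G m 1) -> (forall m x y, G m x -> G m y -> G m (x * y)) ->
  (forall m x, generated_subalgebra (G m) x) ->
  (forall n (x : forall m, A m), (forall m, G m (x m)) ->
    f (\prod_(m < n.+1) tin (A := A) m (x m)) =
    g (\prod_(m < n.+1) tin (A := A) m (x m))) ->
  f =1 g.
Proof.
move=> fL gL G1 GM Ggen fg z.
pose E := [set z : tensor A | exists n (x : forall m, A m),
  (forall m, G m (x m)) /\ z = \prod_(m < n.+1) tin (A := A) m (x m)].
have E1 : E 1.
  exists 0%N, (fun=> 1); split=> //.
  by rewrite big1// => m _; rewrite tin1.
apply: (@eq_on_generated K (tensor A) V E) => //.
- move=> _ _ [n [x [xG ->]]] [n' [x' [xG' ->]]].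
  exists (maxn n n'), (fun m => (if (m < n.+1)%N then x m else 1) *
                                (if (m < n'.+1)%N then x' m else 1)).
  split=> [m|]; first by apply: GM; case: ifP.
  rewrite (@prod_tin_widen n.+1 (maxn n n').+1)// ?ltnS ?leq_maxl//.
  rewrite (@prod_tin_widen n'.+1 (maxn n n').+1)// ?ltnS ?leq_maxr//.
  rewrite -big_split /=; apply: eq_bigr => m _.
  by have [_ ->] := tin_star_hom A m.
- by move=> _ [n [x [xG ->]]]; exact: fg.
have Esub := generated_is_subalgebra E; have [_ EL EM] := Esub.
apply: tensor_generated => // m y.
have [tL tM t1 _] := tin_star_hom A m.
apply: (generated_min
  (C := fun y => generated_subalgebra E (tin (A := A) m y)) _ _ (Ggen m y)).
  split=> [|k a b Ca Cb|a b Ca Cb]; first by rewrite t1; exact: sub_generated.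
    by rewrite tL; exact: EL.
  by rewrite tM; exact: EM.
move=> a Ga; apply: sub_generated.
(* A single entry in slot [m] is the product of length [m.+1] whose earlier entries are units. *)
exists m, (eqtype.dfwith (fun i => 1 : A i) a); split=> [i|].
  by case: eqtype.dfwithP.
rewrite big_ord_recr /= eqtype.dfwith_in big1 ?mul1r// => i _.
by rewrite eqtype.dfwith_out ?tin1// neq_ltn ltn_ord orbT.
Qed.

End SequenceTensor.

(** * The embeddings of the hidden and observed algebras *)

Section HiddenProcess.
Variables (R : realType) (dH dO : nat -> measure_display).
Variables (SH : forall n, measurableType (dH n)).
Variables (SO : forall n, measurableType (dO n)).

Lemma factorH_star_hom m : star_hom (factorH SO (n := m) : H_at R SH m -> _).
Proof. exact: (tin_star_hom (HO_factors R SH SO m) true). Qed.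

Lemma factorO_star_hom m : star_hom (factorO SH (n := m) : O_at R SO m -> _).
Proof. exact: (tin_star_hom (HO_factors R SH SO m) false). Qed.

Lemma jH_star_hom m : star_hom (jH SO (n := m) : H_at R SH m -> _).
Proof.
exact: (star_hom_comp (factorH_star_hom m) (tin_star_hom (HO_at R SH SO) m)).
Qed.

Lemma jO_star_hom m : star_hom (jO SH (n := m) : O_at R SO m -> _).
Proof.
exact: (star_hom_comp (factorO_star_hom m) (tin_star_hom (HO_at R SH SO) m)).
Qed.

Lemma jOjH m (f : Linf R (SO m)) (g : Linf R (SH m)) :
  jO SH f * jH SO g = tin m (factorO SH f * factorH SO g).
Proof. by have [_ ->] := tin_star_hom (HO_at R SH SO) m. Qed.

Lemma factors_generate m (x : HO_at R SH SO m) :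
  generated_subalgebra [set y | exists f g, y = factorO SH f * factorH SO g] x.
Proof.
have [_ _ O1 _] := factorO_star_hom m; have [_ _ H1 _] := factorH_star_hom m.
apply: tensor_generated; first exact: generated_is_subalgebra.
case=> y; apply: sub_generated.
  by exists 1, (y : H_at R SH m); rewrite O1 mul1r.
by exists (y : O_at R SO m), 1; rewrite H1 mulr1.
Qed.

Lemma eq_on_joint (V : lmodType R[i]) (P P' : alg_HO R SH SO -> V) :
  linear P -> linear P' ->
  (forall n (f : forall m, Linf R (SO m)) (g : forall m, Linf R (SH m)),
    P (\prod_(m < n.+1) (jO SH (f m) * jH SO (g m))) =
    P' (\prod_(m < n.+1) (jO SH (f m) * jH SO (g m)))) ->
  P =1 P'.
Proof.
move=> PL PL' PP.
pose G m := [set y : HO_at R SH SO m |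
  exists f g, y = factorO SH f * factorH SO g].
apply: (@eq_on_products _ (HO_at R SH SO) V P P' G) => //.
- move=> m; exists 1, 1.
  have [_ _ -> _] := factorO_star_hom m; have [_ _ -> _] := factorH_star_hom m.
  by rewrite mulr1.
- move=> m _ _ [f [g ->]] [f' [g' ->]]; exists (f * f'), (g * g').
  have [_ -> _ _] := factorO_star_hom m; have [_ -> _ _] := factorH_star_hom m.
  by rewrite mulrACA.
- exact: factors_generate.
- move=> n x xG.
  (* The observed and hidden entries are chosen in turn, because each [g] depends on the chosen
     [f m]. *)
  have [f fP] : exists f : forall m, Linf R (SO m),
      forall m, exists g, x m = factorO SH (f m) * factorH SO g.
    by exists (fun m => sval (cid (xG m))) => m; case: cid.
  have [g gP] : exists g : forall m, Linf R (SH m),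
      forall m, x m = factorO SH (f m) * factorH SO (g m).
    by exists (fun m => sval (cid (fP m))) => m; case: cid.
  have -> : \prod_(m < n.+1) tin (A := HO_at R SH SO) m (x m) =
      \prod_(m < n.+1) (jO SH (f m) * jH SO (g m)).
    by apply: eq_bigr => m _; rewrite jOjH -gP.
  exact: PP.
Qed.

Lemma eq_on_observed (V : lmodType R[i]) (P P' : alg_O R SO -> V) :
  linear P -> linear P' ->
  (forall n (f : forall m, Linf R (SO m)),
    P (\prod_(m < n.+1) inO (f m)) = P' (\prod_(m < n.+1) inO (f m))) ->
  P =1 P'.
Proof.
move=> PL PL' PP.
apply: (@eq_on_products _ (O_at R SO) V P P' (fun=> setT)) => //.
  by move=> m x; exact: sub_generated.
by move=> n x _; exact: PP.
Qed.

Lemma embH_star_hom : star_hom (embH (R := R) (SH := SH) SO).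
Proof.
apply: (@tmap_star_hom _ _ (H_at R SH) (HO_at R SH SO)) => m; last first.
  exact: factorH_star_hom.
by have [] := factorH_star_hom m.
Qed.

Lemma embH_inH m (g : Linf R (SH m)) : embH SO (inH g) = jH SO g.
Proof.
apply: (@tmap_tin _ _ (H_at R SH) (HO_at R SH SO)) => i.
by have [] := factorH_star_hom i.
Qed.

Lemma range_H_image m : range_H m `<=` range (embH (R := R) (SH := SH) SO).
Proof. by move=> _ [g _ <-]; exists (inH g) => //; exact: embH_inH. Qed.

Lemma range_H_star m (x : alg_HO R SH SO) : range_H m x -> range_H m (star x).
Proof.
have [_ _ _ js] := jH_star_hom m.
by move=> [g _ <-]; exists (star (g : H_at R SH m)) => //; exact: js.
Qed.

Lemma range_H_linear m (k : R[i]) (x y : alg_HO R SH SO) :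
  range_H m x -> range_H m y -> range_H m (k *: x + y).
Proof.
have [jL _ _ _] := jH_star_hom m.
by move=> [g _ <-] [h _ <-]; exists (k *: g + h) => //; exact: jL.
Qed.

Lemma range_H_upto_star n (x : alg_HO R SH SO) :
  range_H_upto n x -> range_H_upto n (star x).
Proof.
by apply: generated_star => y [m mn /range_H_star ym]; exists m.
Qed.

Lemma range_H_upto_prod n (g : forall m, Linf R (SH m)) :
  range_H_upto n (\prod_(m < n.+1) jH SO (g m)).
Proof.
apply: subalgebra_prod; first exact: generated_is_subalgebra.
by move=> m _; apply: sub_generated; exists m; [rewrite -ltnS|exists (g m)].
Qed.

(** The image of [embH] is a subalgebra containing the generators. Conditional expectations can then
    be tested on elements [embH SO h], over which [emission] is linear. *)
Lemma range_H_upto_image n :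
  range_H_upto n `<=` range (embH (R := R) (SH := SH) SO).
Proof.
have [eL eM e1 _] := embH_star_hom.
apply: generated_min => [|x [m _ /range_H_image]//].
split=> [|k _ _ [x _ <-] [y _ <-]|_ _ [x _ <-] [y _ <-]].
- by exists 1 => //; exact: e1.
- by exists (k *: x + y) => //; exact: eL.
- by exists (x * y) => //; exact: eM.
Qed.

(** * The joint expectations of a given hidden process *)

Lemma hidden_joint_expectations (P : alg_HO R SH SO -> R[i])
    (B : forall n, Linf R (SO n) -> Linf R (SH n)) :
  is_hidden_process P -> (forall n, is_emission P (B n)) ->
  joint_expectations P (fun x => P (embH SO x)) B.
Proof.
move=> [Pst _ Pex Pind] PB n f g.
have [e eP] := Pex n f.
have BP m : is_condexp P (range_H m) (jO SH (f m)) (jH SO (B m (f m))).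
  have [T [_ TP] ->] := PB m.
  by apply: TP; exists (f m).
have en := Pind n f e _ eP (fun m _ => BP m).
have [PL _ _] := Pst.
rewrite big_split /= eP.2; last exact: range_H_upto_prod.
(* [P] kills multiples of null elements, so against the hidden factors [e] may be exchanged for the
   product of the [jH SO (B m (f m))]. *)
have := null_mul Pst (\prod_(m < n.+1) jH SO (g m)) en.
rewrite mulrC mulrBl (@linB _ _ R[i]^o P PL) => /eqP.
rewrite subr_eq0 => /eqP ->; rewrite -big_split /=.
rewrite (star_hom_prod _ _ embH_star_hom); congr P; apply: eq_bigr => m _.
by rewrite embH_inH; have [_ ->] := jH_star_hom m.
Qed.

(** * The retraction onto the hidden algebra built from emission operators *)

Section Emission.
Variable B : forall n, Linf R (SO n) -> Linf R (SH n).
Arguments B : clear implicits.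
Hypothesis Bmarkov :
  forall n, is_markov [set: Linf R (SO n)] [set: Linf R (SH n)] (B n).

Let BL n : linear (B n).
Proof. by case: (Bmarkov n) => _ BL _ _ k x y; exact: BL. Qed.

Let B1 n : B n 1 = 1.
Proof. by case: (Bmarkov n). Qed.

Definition emit_fam n (b : fam (HO_factors R SH SO n)) : H_at R SH n :=
  (b true : H_at R SH n) * B n (b false).

Definition emit n : HO_at R SH SO n -> H_at R SH n := tlift (@emit_fam n).

Lemma emit_fam_multilinear n : multilinear (@emit_fam n).
Proof.
split=> [[] l a b ab abi|[] a b c abc abci]; rewrite /emit_fam.
- by rewrite -(ab false)// abi [_ * B _ _]/GRing.mul /= scalerAl.
- by rewrite -(ab true)// abi (linZ (@BL n)) scalerAr.
- have [<- <-] := abc false isT.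
  by rewrite abci mulrDl.
- have [<- <-] := abc true isT.
  by rewrite abci (linD (@BL n)) mulrDr.
Qed.

Lemma emit_linear n : linear (@emit n).
Proof. exact: tlift_linear (@emit_fam_multilinear n). Qed.

Lemma emit_tpure n b :
  @emit n (tpure b) = (b true : H_at R SH n) * B n (b false).
Proof. exact: tlift_pure (@emit_fam_multilinear n) b. Qed.

Lemma emit1 n : @emit n 1 = 1.
Proof. by rewrite [LHS]emit_tpure /= B1 mulr1. Qed.

Lemma emit_factors n (f : Linf R (SO n)) (g : Linf R (SH n)) :
  emit (factorO SH f * factorH SO g) = B n f * g.
Proof.
rewrite [_ * factorH _ _]tpureM emit_tpure /= !eqtype.dfwith_in.
by rewrite !eqtype.dfwith_out// mulr1 mul1r mulrC.
Qed.

(** The hidden entry is only multiplied in, so on pure tensors a further hidden factor can be pulled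
    out. This is the one-factor case of [emission_embH]. *)
Lemma emit_factorH n x (g : Linf R (SH n)) :
  emit (x * factorH SO g) = emit x * g.
Proof.
have eL := @emit_linear n.
pose L y := @emit n (y * factorH SO g).
pose L' y : H_at R SH n := @emit n y * g.
have LL : linear L by move=> k a b; rewrite /L mulrDl -scalerAl eL.
have LL' : linear L' by move=> k a b; rewrite /L' eL mulrDl -scalerAl.
apply: (tensor_linear_eq LL LL') => b; rewrite /L /L'.
rewrite [_ * factorH _ _]tpureM !emit_tpure /= eqtype.dfwith_in.
by rewrite eqtype.dfwith_out// mulr1 mulrAC.
Qed.

(** The kernel on pure tensors is the entrywise product of the rank one kernel of the hidden entries
    and the kernel of [B n] on the observed ones. *)
Lemma emit_completely_positive n : completely_positive (@emit n).
Proof.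
apply: tensor_completely_positive; first exact: emit_linear.
move=> s; have Bcp := markov_completely_positive (Bmarkov n).
have BG := gram_map (h := fun b : fam (HO_factors R SH SO n) => b false)
  (Bcp _).
have HG := gram_hom s (fun b => b true : H_at R SH n).
apply: eq_gram (gramM HG (BG s)) => a b _ _.
by rewrite emit_tpure.
Qed.

Definition emission : alg_HO R SH SO -> alg_H R SH := tmap emit1.

Lemma emission_linear : linear emission.
Proof. exact: (tmap_linear emit1 emit_linear). Qed.

Lemma emission1 : emission 1 = 1.
Proof. exact: tmap1 emit_linear. Qed.

Lemma emission_completely_positive : completely_positive emission.
Proof.
exact: (tmap_completely_positive emit1 emit_linear emit_completely_positive).
Qed.

Lemma emission_joint n (f : forall m, Linf R (SO m))
    (g : forall m, Linf R (SH m)) :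
  emission (\prod_(m < n) (jO SH (f m) * jH SO (g m))) =
  \prod_(m < n) inH (B m (f m) * g m).
Proof.
under eq_bigr do rewrite jOjH.
by apply: etrans (tmap_prod_ord emit1 n
  (fun m => factorO SH (f m) * factorH SO (g m)) emit_linear) _;
  apply: eq_bigr => m _; rewrite emit_factors.
Qed.

Lemma emission_jO m (f : Linf R (SO m)) : emission (jO SH f) = inH (B m f).
Proof.
rewrite [LHS](tmap_tin emit1 emit_linear); congr (inH _).
have [_ _ H1 _] := factorH_star_hom m.
by rewrite -[factorO SH f]mulr1 -H1 emit_factors mulr1.
Qed.

Lemma emission_prod_jO n (f : forall m, Linf R (SO m)) :
  emission (\prod_(m < n) jO SH (f m)) = \prod_(m < n) inH (B m (f m)).
Proof.
(* Units are inserted as hidden entries, which makes this an instance of [emission_joint]. *)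
rewrite -[RHS](eq_bigr _
  (fun (m : 'I_n) _ => congr1 (@inH R dH SH m) (mulr1 (B m (f m))))).
rewrite -(emission_joint n f (fun=> 1)); congr emission.
by apply: eq_bigr => m _; have [_ _ -> _] := jH_star_hom m; rewrite mulr1.
Qed.

Lemma emission_embH x h : emission (x * embH SO h) = emission x * h.
Proof.
have [eL eM e1 _] := embH_star_hom; have tL := emission_linear.
(* Quantifying over all [x] makes the set closed under products: the second identity is used at
   [x * embH SO h]. *)
move: h x; apply: (@tensor_generated _ _ (H_at R SH)
  [set h | forall x, emission (x * embH SO h) = emission x * h]).
  split=> /= [x|k h h' hE hE' x|h h' hE hE' x].
  - by rewrite e1 !mulr1.
  - by rewrite eL !mulrDr -!scalerAr tL hE hE'.
  - by rewrite eM !mulrA hE' hE.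
move=> m g x /=; rewrite (embH_inH g).
pose L y := emission (y * jH SO g); pose L' y := emission y * inH g.
have LL : linear L by move=> k a b; rewrite /L mulrDl -scalerAl tL.
have LL' : linear L' by move=> k a b; rewrite /L' tL mulrDl -scalerAl.
apply: (tensor_linear_eq LL LL') => a; rewrite /L /L'.
rewrite [_ * jH _ _]tpureM [emission (tpure _)](tmap_tpure emit1 emit_linear).
rewrite [emission _](tmap_tpure emit1 emit_linear) [RHS]tpureM.
congr tpure; apply: fam_ext => j /=.
have [<-|mj] := eqVneq m j; first by rewrite !eqtype.dfwith_in emit_factorH.
by rewrite !eqtype.dfwith_out// !mulr1.
Qed.

Lemma embHK : cancel (embH SO) emission.
Proof. by move=> h; rewrite -[embH SO h]mul1r emission_embH emission1 mul1r. Qed.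

(** * The state obtained by composing with the retraction, and its conditional expectations *)

Variable PH : alg_H R SH -> R[i].
Hypothesis PHst : is_state PH.

Definition joint_state : alg_HO R SH SO -> R[i] := PH \o emission.

Lemma joint_state_is_state : is_state joint_state.
Proof.
exact: (state_completely_positive PHst emission_linear emission1
  emission_completely_positive).
Qed.

(** By linearity of [emission] over the hidden algebra, both expectations against [embH SO h] equal
    [PH (emission x * h)]. *)
Lemma joint_state_condexp (C : set (alg_HO R SH SO)) x :
  C `<=` range (embH SO) -> C (embH SO (emission x)) ->
  is_condexp joint_state C x (embH SO (emission x)).
Proof.
move=> CH Cx; split=> // _ /CH [h _ <-].
by rewrite /joint_state /= !emission_embH embHK.
Qed.

Lemma joint_state_restricted_condexp m :
  is_restricted_condexp joint_state m (embH SO \o emission).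
Proof.
have [eL eM e1 _] := embH_star_hom.
have jOE (f : Linf R (SO m)) : embH SO (emission (jO SH f)) = jH SO (B m f).
  by rewrite emission_jO embH_inH.
split; last first.
  move=> _ [f _ <-]; apply: joint_state_condexp; first exact: range_H_image.
  by rewrite jOE; exists (B m f).
split=> /=.
- by move=> _ [f _ <-]; rewrite jOE; exists (B m f).
- by move=> k x y _ _; rewrite emission_linear eL.
- by rewrite emission1.
(* The matrix is pulled back along [jO], the positivity of [B m] is applied there, and the resulting
   factor is pushed forward along [jH]. *)
move=> p q X XO.
have [X' XE] : exists X' : 'M[O_at R SO m]_(p, q),
    X = map_mx (jO SH (n := m)) X'.
  exists (\matrix_(i, j) s2val (cid2 (XO i j))); apply/matrixP => i j.
  by rewrite !mxE; case: cid2.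
have [_ _ _ Bcp] := Bmarkov m.
have [//|r [Y [_ YE]]] := Bcp p q X'.
exists r, (map_mx (jH SO (n := m)) Y); split.
  by move=> i j; rewrite mxE; exists (Y i j).
rewrite -(star_hom_mx Y (jH_star_hom m)) -YE XE -(star_hom_mx X' (jO_star_hom m)).
by apply/matrixP => i j; rewrite !mxE /= jOE.
Qed.

Lemma joint_state_prod_condexp n (f : forall m, Linf R (SO m)) :
  is_condexp joint_state (range_H_upto n) (\prod_(m < n.+1) jO SH (f m))
    (\prod_(m < n.+1) jH SO (B m (f m))).
Proof.
have E : embH SO (emission (\prod_(m < n.+1) jO SH (f m))) =
    \prod_(m < n.+1) jH SO (B m (f m)).
  rewrite emission_prod_jO (star_hom_prod _ _ embH_star_hom).
  by apply: eq_bigr => m _; rewrite embH_inH.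
rewrite -E; apply: joint_state_condexp; first exact: range_H_upto_image.
by rewrite E; exact: (range_H_upto_prod (fun m => B m (f m))).
Qed.

Lemma joint_state_hidden : is_hidden_process joint_state.
Proof.
have Pst := joint_state_is_state.
split=> // [m|n f|n f e e_ eP e_P].
- by exists (embH SO \o emission); exact: joint_state_restricted_condexp.
- by eexists; exact: joint_state_prod_condexp.
have [_ CL _] := generated_is_subalgebra
  [set a : alg_HO R SH SO | exists2 m, (m <= n)%N & range_H m a].
have eE := condexp_unique Pst CL (@range_H_upto_star n) eP
  (joint_state_prod_condexp n f).
(* The explicit version is inserted between [e] and the product of the [e_ m]. The first difference
   is null by uniqueness on [range_H_upto n], the second by uniqueness in each factor. *)
rewrite -(subrK (\prod_(m < n.+1) jH SO (B m (f m))) e) -addrA.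
apply: (nullD Pst eE).
apply: (null_prod Pst) => m.
apply: (condexp_unique Pst (@range_H_linear m) (@range_H_star m)) (e_P m _).
  have [_ mP] := joint_state_restricted_condexp m.
  rewrite -embH_inH -emission_jO; apply: (mP (jO SH (f m))).
  by exists (f m).
by rewrite -ltnS.
Qed.

(** Built from the tensor product of the [B n], so that positivity follows from their complete
    positivity. *)
Definition observed_state : alg_O R SO -> R[i] :=
  PH \o tmap (A := O_at R SO) (B := H_at R SH) B1.

Lemma observed_state_process : has_observed_process joint_state observed_state.
Proof.
have tL := tmap_linear (A := O_at R SO) (B := H_at R SH) B1 BL.
split.
  apply: (state_completely_positive PHst tL).
    exact: tmap1.
  apply: tmap_completely_positive => //.
  by move=> n; exact: (markov_completely_positive (Bmarkov n)).
move=> n f; rewrite /observed_state /joint_state /= emission_prod_jO.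
by rewrite (tmap_prod_ord (A := O_at R SO) (B := H_at R SH)).
Qed.

End Emission.

End HiddenProcess.

(** * Assembly of the direct and converse parts *)

Theorem theorem3 (R : realType) (dH dO : nat -> measure_display)
    (SH : forall n : nat, measurableType (dH n))
    (SO : forall n : nat, measurableType (dO n)) :
  (forall (P : alg_HO R SH SO -> R[i])
      (B : forall n : nat, Linf R (SO n) -> Linf R (SH n)),
    is_hidden_process P ->
    (forall n : nat, is_emission P (B n)) ->
    joint_expectations P (fun x : alg_H R SH => P (embH SO x)) B /\
    (forall P' : alg_HO R SH SO -> R[i],
      is_hidden_process P' ->
      (forall x : alg_H R SH, P' (embH SO x) = P (embH SO x)) ->
      (forall n : nat, is_emission P' (B n)) ->
      P' = P))
  /\
  (forall (PH : alg_H R SH -> R[i])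
      (B : forall n : nat, Linf R (SO n) -> Linf R (SH n)),
    is_state PH ->
    (forall n : nat, is_markov [set: Linf R (SO n)] [set: Linf R (SH n)] (B n)) ->
    exists P : alg_HO R SH SO -> R[i],
      [/\ unique (fun Q : alg_HO R SH SO -> R[i] =>
             is_state Q /\ joint_expectations Q PH B) P,
          is_hidden_process P,
          (forall x : alg_H R SH, P (embH SO x) = PH x) &
          exists! PO : alg_O R SO -> R[i], has_observed_process P PO]).
Proof.
split=> [P B Phid PB|PH B PHst Bmarkov].
  have PJ := hidden_joint_expectations Phid PB.
  split=> // P' Phid' PP PB'; have PJ' := hidden_joint_expectations Phid' PB'.
  have [[PL _ _] _ _ _] := Phid; have [[PL' _ _] _ _ _] := Phid'.
  (* [R[i]^o] is the field of scalars as a module over itself, so functionals count as linear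
     maps. *)
  apply/funext; apply: (@eq_on_joint _ _ _ _ _ R[i]^o P' P PL' PL) => n f g.
  by rewrite PJ PJ' PP.
have Pst := joint_state_is_state Bmarkov PHst; have [PL _ _] := Pst.
have PJ : joint_expectations (joint_state Bmarkov PH) PH B.
  by move=> n f g; rewrite /joint_state /= emission_joint.
exists (joint_state Bmarkov PH); split.
- split=> // Q [[QL _ _] QJ].
  apply/funext; apply: (@eq_on_joint _ _ _ _ _ R[i]^o _ Q PL QL) => n f g.
  by rewrite PJ QJ.
- exact: joint_state_hidden.
(* [embH SO] is a right inverse of [emission], so restricting to the hidden algebra returns [PH]. *)
- by move=> x; rewrite /joint_state /= embHK.
- have PO := observed_state_process Bmarkov PHst.
  exists (observed_state Bmarkov PH).
  split=> // Q [[QL _ _] QJ]; have [[POL _ _] POJ] := PO.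
  apply/funext; apply: (@eq_on_observed _ _ _ R[i]^o _ Q POL QL) => n f.
  by rewrite POJ QJ.
Qed.
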